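(* Let $K$ be a field, let $S=\bigoplus_{n\ge 0}S_n=K[u_1,\ldots,u_r]$ be a positively graded $K$-algebra with $u_i$ homogeneous of degree $a_i\geq 1$, let $D=\operatorname{lcm}(a_1,\ldots,a_r)$, let $M=\bigoplus_{n\ge 0}M_n$ be a finitely generated graded $S$-module of Krull dimension $m\ge 0$, and let $w>0$ be a real number. Let $\alpha(M)$, $d_{M,k}$, $\zeta_M(z,w)$ and $\theta_M(z,w)$ be as defined in the context. Then $$\zeta_M(z,w)= \theta_M(z,w)+ D^{-z}\sum_{k=0}^{m-1} \sum_{j=0}^{D-1} d_{M,k}(j+\alpha(M)) \sum_{\ell=0}^k \binom{k}{\ell}(-w)^{\ell} D^{k-\ell}\,\zeta\!\left(z-k+\ell, \frac{j+\alpha(M)+w}{D}\right),$$ where $\zeta(z,x)=\sum_{n=0}^{\infty}\frac{1}{(n+x)^z}$ is the Hurwitz zeta function. Moreover, $\zeta_M(z,w)$ is (by continuation) a meromorphic function of $z$ on $\mathbb C$ whose poles all lie in the set $\{1,2,\ldots,m\}$ and are simple, with residues $$\operatorname{Res}_{z=k+1} \zeta_M(z,w) = \frac{1}{D} \sum_{\ell=k}^{m-1} \binom{\ell}{k}(-w)^{\ell-k}\sum_{j=0}^{D-1} d_{M,\ell}(j),\qquad 0\leq k\leq m-1$$ (a residue of $0$ meaning that there is no pole at that point).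
   Context: A positively graded $K$-algebra is a finitely generated graded $K$-algebra $S=\bigoplus_{n\ge0}S_n$ with $S_0=K$. The Hilbert function of $M$ is $H(M,n)=\dim_K M_n$, $n\ge 0$. By a theorem of Serre there is a quasi-polynomial $q_M(n)=d_{M,m-1}(n)n^{m-1}+\cdots+d_{M,1}(n)n+d_{M,0}(n)$ of degree $m-1$ (with $q_M=0$ if $m=0$), with $d_{M,k}(n+D)=d_{M,k}(n)$ for all $n\ge 0$ and $0\le k\le m-1$, such that $H(M,n)=q_M(n)$ for all $n\gg 0$; this determines the periodic functions $d_{M,k}$. Put $\alpha(M)=\min\{n_0\ge 0: H(M,n)=q_M(n)\text{ for all }n\ge n_0\}$. Define $$\zeta_M(z,w)=\sum_{n\ge 0}\frac{H(M,n)}{(n+w)^z},\qquad \theta_M(z,w)=\sum_{n=0}^{\alpha(M)-1}\frac{H(M,n)}{(n+w)^z}.$$ The series for $\zeta_M(z,w)$ converges absolutely for $\operatorname{Re} z>m$ and is understood by meromorphic continuation elsewhere; the Hurwitz zeta function is likewise understood by its meromorphic continuation. *)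

(* Defs.v *)
From mathcomp Require Import all_boot all_order all_algebra.
From mathcomp Require Import all_classical all_reals all_analysis.
From mathcomp Require Export complex.

Set Implicit Arguments.
Unset Strict Implicit.
Unset Printing Implicit Defensive.

Import Order.TTheory GRing.Theory Num.Theory.
Import numFieldNormedType.Exports.

Local Open Scope classical_set_scope.
Local Open Scope ring_scope.

Definition additive_subgroup (V : zmodType) (A : set V) : Prop :=
  A 0 /\ forall x y, A x -> A y -> A (x - y).

(* internal direct sum V = \bigoplus_n gr n *)
Definition is_grading (V : zmodType) (gr : nat -> set V) : Prop :=
  [/\ forall n, additive_subgroup (gr n),
      forall x : V, exists N (f : nat -> V),
        (forall n, gr n (f n)) /\ x = \sum_(n < N) f n
    & forall N (f : nat -> V), (forall n, gr n (f n)) ->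
        \sum_(n < N) f n = 0 -> forall n, (n < N)%N -> f n = 0].

Definition is_graded_ring (S : comNzRingType) (gr : nat -> set S) : Prop :=
  [/\ is_grading gr, gr 0%N 1
    & forall i j x y, gr i x -> gr j y -> gr (i + j)%N (x * y)].

Definition is_subalgebra (K : fieldType) (S : comAlgType K) (A : set S) : Prop :=
  [/\ A 1, forall (c : K) x y, A x -> A y -> A (c *: x + y)
    & forall x y, A x -> A y -> A (x * y)].

(* S = K[u_1, ..., u_r] *)
Definition generates_algebra (K : fieldType) (S : comAlgType K) (r : nat)
    (u : 'I_r -> S) : Prop :=
  forall A : set S, is_subalgebra A -> (forall i, A (u i)) -> A = setT.

(* The homogeneous components are K-subspaces because gr 0 = K and
   gr 0 * gr n `<=` gr n. *)
Definition positively_graded_algebra (K : fieldType) (S : comAlgType K)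
    (gr : nat -> set S) (r : nat) (u : 'I_r -> S) (a : 'I_r -> nat) : Prop :=
  [/\ is_graded_ring gr, gr 0%N = range (fun c : K => c%:A),
      forall i, (0 < a i)%N /\ gr (a i) (u i)
    & generates_algebra u].

Definition is_graded_module (S : comNzRingType) (grS : nat -> set S)
    (M : lmodType S) (grM : nat -> set M) : Prop :=
  is_grading grM /\
  forall i j s x, grS i s -> grM j x -> grM (i + j)%N (s *: x).

Definition finitely_generated (S : comNzRingType) (M : lmodType S) : Prop :=
  exists (t : nat) (g : 'I_t -> M), forall x : M,
    exists c : 'I_t -> S, x = \sum_(i < t) c i *: g i.

Definition is_prime_ideal (S : comNzRingType) (p : {pred S}) : Prop :=
  idealr_closed p /\ prime_idealr_closed p.

(* a chain p 0 < p 1 < ... < p n of prime ideals containing Ann M *)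
Definition prime_chain (S : comNzRingType) (M : lmodType S) (n : nat)
    (p : nat -> {pred S}) : Prop :=
  (forall i, (i <= n)%N -> is_prime_ideal (p i) /\
     forall s : S, (forall x : M, s *: x = 0) -> s \in p i) /\
  (forall i, (i < n)%N ->
     {subset p i <= p i.+1} /\ exists2 s, s \in p i.+1 & s \notin p i).

(* dim M = dim (S / Ann M); no m satisfies this when M = 0. *)
Definition has_krull_dim (S : comNzRingType) (M : lmodType S) (m : nat) : Prop :=
  (exists p, prime_chain M m p) /\
  (forall n p, prime_chain M n p -> (n <= m)%N).

(* The K-vector space structure of an S-module is c, x |-> c%:A *: x. *)
Definition has_dim (K : fieldType) (S : comAlgType K) (M : lmodType S)
    (A : set M) (d : nat) : Prop :=
  exists b : 'I_d -> M,
    [/\ forall i, A (b i),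
        forall x, A x -> exists c : 'I_d -> K, x = \sum_(i < d) (c i)%:A *: b i
      & forall c : 'I_d -> K, \sum_(i < d) (c i)%:A *: b i = 0 ->
          forall i, c i = 0].

Definition hilbert (K : fieldType) (S : comAlgType K) (M : lmodType S)
    (grM : nat -> set M) (n : nat) : nat :=
  xget 0%N [set d | has_dim (grM n) d].

Section ComplexAnalysis.
Variable R : realType.
Local Notation C := R[i].
Implicit Types (f F : C -> C) (p z : C) (c : nat -> C).

(* x ^ z = exp (z ln x) for real x > 0 *)
Definition cpow (x : R) z : C :=
  let rho := x `^ (complex.Re z) in let phi := complex.Im z * ln x in
  ((rho * cos phi) +i* (rho * sin phi))%C.

(* the power series with coefficients c centred at p converges to l at z *)
Definition psum c p z (l : C) : Prop :=
  series (fun n => c n * (z - p) ^+ n : (C : numFieldType)) @ \oo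
    --> (l : (C : numFieldType)).

Definition analytic_at f p : Prop :=
  exists c, \forall z \near (p : (C : numFieldType)), psum c p z (f z).

(* On a punctured neighbourhood of p,
   f z = \sum_n c n * (z - p) ^ (n - N). *)
Definition laurent_at f p (N : nat) c : Prop :=
  \forall z \near (p : (C : numFieldType))^', psum c p z ((z - p) ^+ N * f z).

Definition pole_of_order f p (N : nat) : Prop :=
  (0 < N)%N /\ exists2 c, c 0%N != 0 & laurent_at f p N c.

Definition is_pole f p : Prop := exists N, pole_of_order f p N.

(* Removable singularities are required to be removed, so f z is meaningful at
   every z which is not a pole; the value of f at a pole is irrelevant. *)
Definition meromorphic f : Prop := forall p, analytic_at f p \/ is_pole f p.

(* the coefficient of (z - p)^-1 in the Laurent expansion of f at p *)
Definition is_residue f p (rho : C) : Prop :=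
  exists N c, laurent_at f p N c /\ rho = if N is N'.+1 then c N' else 0.

Definition residue f p : C := xget 0 [set rho | is_residue f p rho].

(* F is meromorphic on the plane and equal to \sum_n u n z, a convergent series,
   on the half-plane Re z > s. *)
Definition meromorphic_continuation (u : nat -> C -> C) (s : R) F : Prop :=
  meromorphic F /\
  forall z, s < complex.Re z ->
    series (fun n => u n z : (C : numFieldType)) @ \oo
      --> (F z : (C : numFieldType)).

Definition continued_series (u : nat -> C -> C) (s : R) : C -> C :=
  xget (fun=> 0) [set F | meromorphic_continuation u s F].

Definition hurwitz_zeta z (x : R) : C :=
  continued_series (fun n s => (cpow (n%:R + x) s)^-1) 1 z.

Definition quasi_poly (m : nat) (d : nat -> nat -> C) (n : nat) : C :=
  \sum_(k < m) d k n * n%:R ^+ k.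

Definition agree_from (H : nat -> nat) (q : nat -> C) (n0 : nat) : Prop :=
  forall n, (n0 <= n)%N -> (H n)%:R = q n.

(* d k is the coefficient of n ^ k in the quasi-polynomial of degree m - 1 and
   period D attached to H; for m = 0 the quasi-polynomial is 0. *)
Definition is_quasi_poly_of (H : nat -> nat) (D m : nat)
    (d : nat -> nat -> C) : Prop :=
  [/\ forall k n, (k < m)%N -> d k (n + D)%N = d k n,
      (0 < m)%N -> exists n, d m.-1 n != 0
    & exists n0, agree_from H (quasi_poly m d) n0].

Definition alpha (H : nat -> nat) (q : nat -> C) : nat :=
  xget 0%N [set n0 | agree_from H q n0 /\
                     forall n1, agree_from H q n1 -> (n0 <= n1)%N].

Definition zeta_term (H : nat -> nat) (w : R) (n : nat) z : C :=
  (H n)%:R / cpow (n%:R + w) z.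

Definition zeta_mod (H : nat -> nat) (m : nat) (w : R) : C -> C :=
  continued_series (zeta_term H w) m%:R.

Definition theta_mod (H : nat -> nat) (al : nat) (w : R) z : C :=
  \sum_(n < al) zeta_term H w n z.

End ComplexAnalysis.

(* Main.v *)
Require Import Defs.
From mathcomp Require Import all_boot all_order all_algebra.
From mathcomp Require Import all_classical all_reals all_analysis.
From mathcomp Require Import complex.
From mathcomp Require Import ring lra zify.
Import Order.TTheory GRing.Theory Num.Theory.
Import numFieldNormedType.Exports.
Local Open Scope classical_set_scope.
Local Open Scope ring_scope.

Set Implicit Arguments.
Unset Strict Implicit.
Unset Printing Implicit Defensive.

(* Everything is reduced to the Hurwitz zeta function. An analytic function is
   handled through the l^1 norm sum_j |c_j| r^j of its Taylor coefficients on a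
   disc, which is submultiplicative; a series of functions whose norms are
   summable is then analytic without any complex integration.

   To continue zeta(z, x), write y_n = n + x, expand the telescoping series
   x^s = sum_n (y_n^s - y_(n+1)^s), s = 1 - z, by the binomial series of
   (1 + 1 / y_n)^s up to order K, and get
     (z - 1) zeta(z, x) = x^s + sum_(2 <= k < K) binom(s, k) zeta(z + k - 1, x)
                              + sum_n y_n^s * (remainder of order y_n^(- K)).
   Since binom(s, k) is divisible by z + k - 2, the right-hand side only involves
   W(z) = (z - 1) zeta(z, x) at z + 1, z + 2, etc., so W extends from the
   half-plane Re z > 1 - N to Re z > - N, and W(1) = 1.

   For Re z > m the series of M splits into residue classes modulo D, and
   n^k = ((n + w) - w)^k turns each class into Hurwitz zeta functions. By the
   identity theorem, the continuation is the sum of an entire function and of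
   the simple fractions at 1, ..., m. *)

(** * The complex modulus with real values, and convergence of complex series *)

Section Norm.
Variable R : realType.
Local Notation C := R[i].
Implicit Types (x y z : C) (e : R).

(** Uniform convergence alone does not control Taylor coefficients unless Cauchy's formula is at
    hand; a bound on the l^1 norm does, and it lets the sum over n and the sum over the coefficients
    be exchanged. The price is that each remainder of the binomial series must be bounded in this
    norm on a disc of the variable s, uniformly in n, and not just pointwise. This is why (1 + 1 /
    y_n)^s is written exp(s lam): the tail of the exponential series is visibly of order lam^K in
    norm, and the truncated exponential and binomial series differ by a polynomial in s of degree <
    K, recovered by interpolation at 0, ..., K - 1, where its values are exponential tails too. A
    second constraint is that [continued_series] is only some continuation, with arbitrary values at
    its poles. Two continuations are therefore compared on punctured neighbourhoods; the requirement
    that removable singularities be removed then restores equality of values wherever one of them is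
    holomorphic. *)

Definition cabs (z : C) : R := Normc.normc z.

Lemma normE z : `|z| = (cabs z)%:C%C.
Proof. by rewrite normc_def; case: z. Qed.

Lemma cabs_ge0 z : 0 <= cabs z.
Proof. by rewrite -ler0c -normE. Qed.

Lemma cabsD x y : cabs (x + y) <= cabs x + cabs y.
Proof. exact: le_normcD. Qed.

Lemma cabsM x y : cabs (x * y) = cabs x * cabs y.
Proof. exact: Normc.normcM. Qed.

Lemma cabsN x : cabs (- x) = cabs x.
Proof. exact: normcN. Qed.

Lemma cabsB x y : cabs (x - y) = cabs (y - x).
Proof. by rewrite -cabsN opprB. Qed.

Lemma cabs0 : cabs 0 = 0.
Proof. exact: Normc.normc0. Qed.

Lemma cabs1 : cabs 1 = 1.
Proof. exact: Normc.normc1. Qed.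

Lemma cabsV x : cabs x^-1 = (cabs x)^-1.
Proof. exact: Normc.normcV. Qed.

Lemma cabsX x n : cabs (x ^+ n) = cabs x ^+ n.
Proof. by elim: n => [|n IH]; rewrite ?expr0 ?cabs1 // !exprS cabsM IH. Qed.

Lemma cabs_eq0 x : (cabs x == 0) = (x == 0).
Proof. by apply/eqP/eqP => [/Normc.eq0_normc //|->]; exact: cabs0. Qed.

Lemma cabs_gt0 x : (0 < cabs x) = (x != 0).
Proof. by rewrite lt_def cabs_ge0 andbT cabs_eq0. Qed.

Lemma cabs_real (a : R) : cabs a%:C%C = `|a|.
Proof. by rewrite /cabs /= expr0n /= addr0 sqrtr_sqr. Qed.

Lemma cabs_nat n : cabs n%:R = n%:R.
Proof. by rewrite -(rmorph_nat (real_complex R)) cabs_real ger0_norm. Qed.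

Lemma cabs_sum (I : Type) (s : seq I) (P : pred I) (F : I -> C) :
  cabs (\sum_(i <- s | P i) F i) <= \sum_(i <- s | P i) cabs (F i).
Proof.
elim/big_ind2: _ => //; first by rewrite cabs0.
by move=> a b a' b' h1 h2; apply: le_trans (cabsD _ _) _; apply: lerD.
Qed.

Lemma cabs_Re z : `|complex.Re z| <= cabs z.
Proof. by rewrite -lecR -normE normc_ge_Re. Qed.

Lemma cabs_Im z : `|complex.Im z| <= cabs z.
Proof.
case: z => a b /=; rewrite /cabs /= -sqrtr_sqr ler_sqrt ?addr_ge0 ?sqr_ge0 //.
by rewrite lerDr sqr_ge0.
Qed.

Lemma cabs_ReIm z : cabs z <= `|complex.Re z| + `|complex.Im z|.
Proof.
rewrite [in leLHS](complexE z); apply: le_trans (cabsD _ _) _.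
rewrite cabsM !cabs_real lerD2l.
suff -> : cabs 'i%C = 1 by rewrite mul1r.
by rewrite /cabs /= expr0n /= add0r expr1n sqrtr1.
Qed.

(** Balls of the field C have a complex radius [e], but [0 < e] forces [e] to be real, so real radii
    give the same neighbourhoods. *)
Lemma nbhs_cabsP (p : C) (P : C -> Prop) :
  (\forall z \near (p : (C : numFieldType)), P z) <->
  exists2 e, 0 < e & forall z, cabs (z - p) < e -> P z.
Proof.
split.
  move=> /nbhs_ballP[e /= e0 He]; exists (complex.Re e).
    by move: e0; rewrite ltcE => /andP[].
  move=> z hz; apply: He; rewrite /ball /= normE cabsB.
  move: e0; rewrite ltcE => /andP[/eqP ie _].
  by rewrite ltcE /= ie eqxx.
move=> [e e0 He]; apply/nbhs_ballP; exists e%:C%C; first by rewrite /= ltcR.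
by move=> z; rewrite /ball /= normE ltcR cabsB; exact: He.
Qed.

Lemma dnbhs_cabsP (p : C) (P : C -> Prop) :
  (\forall z \near (p : (C : numFieldType))^', P z) <->
  exists2 e, 0 < e & forall z, z != p -> cabs (z - p) < e -> P z.
Proof.
rewrite /dnbhs /within /=; split.
  by move=> /nbhs_cabsP[e e0 He]; exists e => // z zp /He; exact.
by move=> [e e0 He]; apply/nbhs_cabsP; exists e => // z hz zp; apply: He.
Qed.

Definition csum (u : nat -> C) (l : C) : Prop :=
  forall e, 0 < e -> exists N, forall n, (N <= n)%N ->
    cabs (\sum_(i < n) u i - l) < e.

Lemma csumP (u : nat -> C) (l : C) :
  (series (fun n => u n : (C : numFieldType)) @ \oo --> (l : (C : numFieldType)))
  <-> csum u l.
Proof.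
split.
  move=> h e e0.
  have /h : \forall z \near (l : (C : numFieldType)), cabs (z - l) < e.
    by apply/nbhs_cabsP; exists e.
  case=> N _ hN; exists N => n Nn; have := hN n Nn.
  by rewrite /series /= big_mkord.
move=> h P /nbhs_cabsP[e e0 He]; have [N hN] := h _ e0.
exists N => // n Nn; apply: He; rewrite /series /= big_mkord; exact: hN.
Qed.
End Norm.

Arguments cabs {R} z : simpl never.

Lemma sum_ord_split (V : nmodType) (F : nat -> V) n n' : (n <= n')%N ->
  \sum_(i < n') F i = \sum_(i < n) F i + \sum_(i < n' - n) F (n + i)%N.
Proof. by move=> nn; rewrite -[in LHS](subnKC nn) big_split_ord. Qed.

Lemma addDBl (V : zmodType) (x y : V) : x + y - x = y.
Proof. by rewrite addrAC subrr add0r. Qed.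

(** * Sums of complex series and exchange of double sums *)

Section Series.
Variable R : realType.
Local Notation C := R[i].
Implicit Types (x y z : C) (e B : R) (u v : nat -> C).

Lemma csum_ext u v l : u =1 v -> csum u l -> csum v l.
Proof. by move=> /funext ->. Qed.

Lemma csum_le u l B : (forall n, cabs (\sum_(i < n) u i) <= B) -> csum u l ->
  cabs l <= B.
Proof.
move=> hB hu; apply/ler_addgt0Pr => e e0; have [N /(_ N (leqnn N)) hN] := hu e e0.
have := cabsD (l - \sum_(i < N) u i) (\sum_(i < N) u i).
rewrite subrK cabsB => h; apply: (le_trans h).
by rewrite addrC; apply: lerD (hB N) (ltW hN).
Qed.

Lemma csum_uniq u l l' : csum u l -> csum u l' -> l = l'.
Proof.
move=> h h'; apply/eqP; rewrite -subr_eq0 -cabs_eq0; apply/eqP/le_anti.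
rewrite cabs_ge0 andbT; apply/ler_addgt0Pr => e e0; rewrite add0r.
have e2 : 0 < e / 2 by rewrite divr_gt0.
have [N hN] := h _ e2; have [N' hN'] := h' _ e2.
have {}hN := hN _ (leq_maxl N N'); have {}hN' := hN' _ (leq_maxr N N').
set s := \sum_(i < _) _ in hN hN'.
have -> : l - l' = (l - s) + (s - l') by ring.
apply: le_trans (cabsD _ _) _; rewrite (cabsB l); lra.
Qed.

Lemma csumD u v l l' : csum u l -> csum v l' ->
  csum (fun n => u n + v n) (l + l').
Proof.
move=> h h' e e0; have e2 : 0 < e / 2 by rewrite divr_gt0.
have [N hN] := h _ e2; have [N' hN'] := h' _ e2; exists (maxn N N') => n.
rewrite geq_max => /andP[/hN {}hN /hN' {}hN']; rewrite big_split /= opprD addrACA.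
apply: le_lt_trans (cabsD _ _) _; lra.
Qed.

Lemma csumZ a u l : csum u l -> csum (fun n => a * u n) (a * l).
Proof.
move=> h e e0; have a1 : 0 < cabs a + 1 by rewrite ltr_wpDl ?cabs_ge0.
have [|N hN] := h (e / (cabs a + 1)); first by rewrite divr_gt0.
exists N => n /hN {}hN; rewrite -mulr_sumr -mulrBr cabsM.
rewrite ltr_pdivlMr // in hN; apply: le_lt_trans hN.
by rewrite mulrC ler_wpM2l ?cabs_ge0 // lerDl.
Qed.

Lemma csum_fin u N : (forall i, (N <= i)%N -> u i = 0) ->
  csum u (\sum_(i < N) u i).
Proof.
move=> h e e0; exists N => n Nn.
rewrite -(subnKC Nn) big_split_ord /= addrAC subrr add0r big1 ?cabs0 // => i _.
by rewrite h // leq_addr.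
Qed.

Lemma csum0 : csum (fun=> 0 : C) 0.
Proof. by have := @csum_fin (fun=> 0) 0%N (fun _ _ => erefl); rewrite big_ord0. Qed.

Lemma csum_sum (I : Type) (s : seq I) (u : I -> nat -> C) (l : I -> C) :
  (forall i, csum (u i) (l i)) ->
  csum (fun n => \sum_(i <- s) u i n) (\sum_(i <- s) l i).
Proof.
move=> h; elim: s => [|i s IH].
  by rewrite big_nil; apply: csum_ext csum0 => n; rewrite big_nil.
rewrite big_cons; apply: csum_ext (csumD (h i) IH) => n.
by rewrite big_cons.
Qed.

Lemma csum_recl u l : csum (fun n => u n.+1) l -> csum u (u 0%N + l).
Proof.
move=> h e e0; have [N hN] := h _ e0; exists N.+1 => -[//|n]; rewrite ltnS => /hN.
by rewrite big_ord_recl /= opprD addrACA subrr add0r.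
Qed.

Lemma csum_recr u l : csum u l -> csum (fun n => u n.+1) (l - u 0%N).
Proof.
move=> h e e0; have [N hN] := h _ e0; exists N => n Nn.
have := hN n.+1 (leqW Nn); rewrite big_ord_recl /=.
by rewrite opprB addrCA addrA.
Qed.

Lemma csum_drop u l N : csum u l -> csum (fun n => u (n + N)%N) (l - \sum_(i < N) u i).
Proof.
move=> h; elim: N => [|N IH].
  by rewrite big_ord0 subr0; apply: csum_ext h => n; rewrite addn0.
rewrite big_ord_recr /= opprD addrA.
by apply: csum_ext (csum_recr IH) => n; rewrite addSnnS.
Qed.

Lemma csum_undrop u l N : csum (fun n => u (n + N)%N) l ->
  csum u (\sum_(i < N) u i + l).
Proof.
elim: N l => [|N IH] l h.
  by rewrite big_ord0 add0r; apply: csum_ext h => n; rewrite addn0.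
rewrite big_ord_recr /= -addrA; apply: IH.
apply: (csum_recl (u := fun n => u (n + N)%N)).
by apply: csum_ext h => n; rewrite addSnnS.
Qed.

Lemma sum_le_widen (b : nat -> R) n m : (forall i, 0 <= b i) -> (n <= m)%N ->
  \sum_(i < n) b i <= \sum_(i < m) b i.
Proof.
move=> b0 le_nm; rewrite -(subnKC le_nm) big_split_ord /= lerDl.
by apply: sumr_ge0 => i _; exact: b0.
Qed.

Lemma csum_complex u (a b : R) :
  series (fun n => complex.Re (u n)) @ \oo --> a ->
  series (fun n => complex.Im (u n)) @ \oo --> b -> csum u (a +i* b)%C.
Proof.
move=> /cvgrPdist_lt ha /cvgrPdist_lt hb.
move=> e e0; have e2 : 0 < e / 2 by rewrite divr_gt0.
have [N _ hN] := ha _ e2; have [N' _ hN'] := hb _ e2; exists (maxn N N') => n.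
rewrite geq_max => /andP[/hN {}hN /hN' {}hN'].
have hR : complex.Re (\sum_(i < n) u i) = \sum_(i < n) complex.Re (u i).
  by elim/big_rec2: _ => //= i y1 y2 _ <-; case: (u i) => ? ?; case: y2.
have hI : complex.Im (\sum_(i < n) u i) = \sum_(i < n) complex.Im (u i).
  by elim/big_rec2: _ => //= i y1 y2 _ <-; case: (u i) => ? ?; case: y2.
rewrite /series /= big_mkord -hR distrC in hN; rewrite /series /= big_mkord -hI distrC in hN'.
move: (\sum_(i < n) u i) hN hN' => [x y] /= hN hN'.
apply: le_lt_trans (cabs_ReIm _) _ => /=; lra.
Qed.

Lemma real_series_cvg (u : nat -> R) B :
  (forall n, \sum_(i < n) `|u i| <= B) -> exists l : R, series u @ \oo --> l.
Proof.
move=> hB; apply/cvg_ex/normed_cvg; apply: nondecreasing_is_cvgn.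
  move=> n m le_nm; rewrite /normed_series_of /series /= !big_mkord.
  by apply: (@sum_le_widen (fun i => `|u i|)).
exists B => _ [n _ <-]; rewrite /normed_series_of /series /= big_mkord; exact: hB.
Qed.

Lemma csum_ex u B : (forall n, \sum_(i < n) cabs (u i) <= B) ->
  exists2 l, csum u l & cabs l <= B.
Proof.
move=> hB.
have [|a ha] := @real_series_cvg (fun n => complex.Re (u n)) B.
  move=> n; apply: le_trans (hB n); apply: ler_sum => i _; exact: cabs_Re.
have [|b hb] := @real_series_cvg (fun n => complex.Im (u n)) B.
  move=> n; apply: le_trans (hB n); apply: ler_sum => i _; exact: cabs_Im.
have hs := csum_complex ha hb; exists (a +i* b)%C => //; apply: csum_le hs => n.
exact: le_trans (cabs_sum _ _ _) (hB n).
Qed.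

(** The sums of |u i j| over rectangles have a supremum, and once a rectangle comes close to it,
    every larger rectangle changes the sum of [u] by little. Row sums and column sums are then
    compared with one and the same rectangle. *)
Lemma csum_fubini (u : nat -> nat -> C) (a b : nat -> C) B S :
  (forall n m, \sum_(i < n) \sum_(j < m) cabs (u i j) <= B) ->
  (forall i, csum (u i) (a i)) -> (forall j, csum (u^~ j) (b j)) ->
  csum a S -> csum b S.
Proof.
move=> hB ha hb haS.
pose T n m := \sum_(i < n) \sum_(j < m) cabs (u i j).
have Tmono n m n' m' : (n <= n')%N -> (m <= m')%N -> T n m <= T n' m'.
  move=> nn mm; apply: (@le_trans _ _ (T n m')).
    by apply: ler_sum => i _; apply: (@sum_le_widen (fun j => cabs (u i j))) => // j; exact: cabs_ge0.
  apply: (@sum_le_widen (fun i => \sum_(j < m') cabs (u i j))) => // i.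
  by apply: sumr_ge0 => j _; exact: cabs_ge0.
pose E := [set T p.1 p.2 | p in (setT : set (nat * nat))].
have hE : has_sup E.
  split; first by exists (T 0%N 0%N), (0%N, 0%N).
  by exists B => _ [[n m] _ <-]; exact: hB.
(* Two nested rectangles differ by an L-shaped region, on which the sum of [u] is bounded by that of
   its moduli. *)
have diff n m n' m' : (n <= n')%N -> (m <= m')%N ->
    cabs (\sum_(i < n') \sum_(j < m') u i j - \sum_(i < n) \sum_(j < m) u i j)
    <= T n' m' - T n m.
  move=> nn mm.
  have split (V : zmodType) (g : nat -> nat -> V) :
      \sum_(i < n') \sum_(j < m') g i j =
      \sum_(i < n) \sum_(j < m) g i j +
      (\sum_(i < n) \sum_(j < m' - m) g i (m + j)%N +
       \sum_(i < n' - n) \sum_(j < m') g (n + i)%N j).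
    rewrite (sum_ord_split (fun i => \sum_(j < m') g i j) nn) addrA -big_split /=.
    by congr (_ + _); apply: eq_bigr => i _; rewrite (sum_ord_split _ mm).
  rewrite /T (split _ u) (split _ (fun i j => cabs (u i j))) !addDBl.
  apply: le_trans (cabsD _ _) _; apply: lerD.
    by apply: le_trans (cabs_sum _ _ _) _; apply: ler_sum => i _; exact: cabs_sum.
  by apply: le_trans (cabs_sum _ _ _) _; apply: ler_sum => i _; exact: cabs_sum.
have key e : 0 < e -> exists n0 m0, forall n m, (n0 <= n)%N -> (m0 <= m)%N ->
    cabs (\sum_(i < n) \sum_(j < m) u i j - \sum_(i < n0) \sum_(j < m0) u i j) <= e.
  move=> e0; have [_ [[n0 m0] _ <-] h0] := sup_adherent e0 hE.
  exists n0, m0 => n m hn hm; apply: le_trans (diff _ _ _ _ hn hm) _.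
  have : T n m <= sup E by apply: ub_le_sup; [case: hE|exists (n, m)].
  move: h0 => /=; lra.
move=> e e0; have e4 : 0 < e / 5 by rewrite divr_gt0.
have [n0 [m0 h]] := key _ e4.
set Z := \sum_(i < n0) _ in h.
(* Finitely many rows are approximated at once by a common, arbitrarily large number of columns;
   this serves for [u] and for its transpose. *)
have fin (n : nat) (v : nat -> nat -> C) (c : nat -> C) : (forall i, csum (v i) (c i)) ->
    forall m1, exists2 m, (m1 <= m)%N &
    cabs (\sum_(i < n) \sum_(j < m) v i j - \sum_(i < n) c i) < e / 5.
  move=> hv m1; have := @csum_sum _ (enum 'I_n) _ _ (fun i : 'I_n => hv i).
  rewrite big_enum => /(_ _ e4)[m hm]; exists (maxn m1 m); first exact: leq_maxl.
  have := hm _ (leq_maxr m1 m); under [X in cabs (X - _)]eq_bigr do rewrite big_enum /=.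
  by rewrite exchange_big.
(* Three of the five portions e / 5 are spent between [S] and the fixed rectangle sum [Z]; the other
   two lead from [Z] to the partial sums of [b]. *)
have hA : cabs (S - Z) <= e / 5 + e / 5 + e / 5.
  have [N /(_ (maxn N n0) (leq_maxl _ _)) hN] := haS _ e4.
  have [m mm hm] := fin (maxn N n0) u a ha m0.
  have := h (maxn N n0) m (leq_maxr _ _) mm.
  set A1 := \sum_(i < maxn N n0) \sum_(j < m) _ in hm *; set A2 := \sum_(i < _) a i in hm hN *.
  move=> h1.
  have -> : S - Z = (S - A2) + (A2 - A1) + (A1 - Z) by ring.
  apply: le_trans (cabsD _ _) _; apply: lerD => //.
  apply: le_trans (cabsD _ _) _; rewrite (cabsB S) (cabsB A2 A1); apply: lerD; exact: ltW.
exists m0 => m hm.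
have [n nn hn] := fin m (fun j i => u i j) b hb n0.
have := h n m nn hm; rewrite exchange_big /=.
set A1 := \sum_(i < m) \sum_(j < n) _ in hn *; set A2 := \sum_(i < _) b i in hn *.
move=> h1.
have -> : A2 - S = (A2 - A1) + (A1 - Z) + (Z - S) by ring.
have hl := cabsD (A2 - A1 + (A1 - Z)) (Z - S).
have hl' := cabsD (A2 - A1) (A1 - Z).
rewrite (cabsB Z) in hl; rewrite (cabsB A2 A1) in hl'; lra.
Qed.

End Series.

(** * Cauchy products of absolutely convergent series *)

Section Cauchy.
Variable R : realType.
Local Notation C := R[i].
Implicit Types (a b : nat -> C) (A B : R).

Lemma sum_shift_le (b : nat -> R) B i m : (forall j, 0 <= b j) ->
  (forall n, \sum_(j < n) b j <= B) ->
  \sum_(j < m) (if (i <= j)%N then b (j - i)%N else 0) <= B.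
Proof.
move=> b0 hB; have [im|mi] := leqP i m.
  rewrite (sum_ord_split (fun j => if (i <= j)%N then b (j - i)%N else 0) im).
  rewrite big1 ?add0r => [|j _]; last by rewrite leqNgt ltn_ord.
  apply: le_trans (hB (m - i)%N); apply: ler_sum => j _.
  by rewrite leq_addr addKn.
rewrite big1; first by have := hB 0%N; rewrite big_ord0.
by move=> j _; rewrite leqNgt (ltn_trans (ltn_ord j) mi).
Qed.

Lemma cauchy_double_le (a b : nat -> R) A B n m :
  (forall j, 0 <= a j) -> (forall j, 0 <= b j) ->
  (forall k, \sum_(i < k) a i <= A) -> (forall k, \sum_(i < k) b i <= B) ->
  \sum_(i < n) \sum_(j < m) (if (i <= j)%N then a i * b (j - i)%N else 0) <= A * B.
Proof.
move=> a0 b0 hA hB; have B0 : 0 <= B by have := hB 0%N; rewrite big_ord0.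
apply: (@le_trans _ _ (\sum_(i < n) a i * B)).
  apply: ler_sum => i _; apply: le_trans (ler_wpM2l (a0 i) (sum_shift_le i m b0 hB)).
  rewrite mulr_sumr; apply: ler_sum => j _.
  by case: ifP => // _; rewrite mulr0.
by rewrite -mulr_suml ler_wpM2r.
Qed.

Lemma csum_shift b l i : csum b l ->
  csum (fun j => if (i <= j)%N then b (j - i)%N else 0) l.
Proof.
move=> h; pose u j := if (i <= j)%N then b (j - i)%N else 0.
have /csum_undrop : csum (fun n => u (n + i)%N) l.
  by apply: csum_ext h => n; rewrite /u leq_addl addnK.
by rewrite big1 ?add0r // => j _; rewrite /u leqNgt ltn_ord.
Qed.

(** Row [i] of the triangular array holds [a i * b (j - i)] for [i <= j] and sums to [a i * lb];
    column [j] is finite and is the j-th term of the product, so exchanging the double sum is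
    enough. *)
Lemma csum_cauchy a b la lb A B :
  (forall k, \sum_(i < k) cabs (a i) <= A) -> (forall k, \sum_(i < k) cabs (b i) <= B) ->
  csum a la -> csum b lb ->
  csum (fun n => \sum_(i < n.+1) a i * b (n - i)%N) (la * lb).
Proof.
move=> hA hB ha hb.
pose u i j : C := if (i <= j)%N then a i * b (j - i)%N else 0.
apply: (@csum_fubini _ u (fun i => a i * lb) _ (A * B)).
- move=> n m; apply: le_trans (cauchy_double_le n m (fun j => cabs_ge0 (a j))
    (fun j => cabs_ge0 (b j)) hA hB).
  apply: ler_sum => i _; apply: ler_sum => j _; rewrite /u.
  by case: ifP => _; rewrite ?cabs0 // cabsM.
- move=> i; apply: csum_ext (csumZ (a i) (csum_shift i hb)) => j.
  by rewrite /u; case: ifP => //; rewrite mulr0.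
- move=> j; have : csum (u^~ j) (\sum_(i < j.+1) u i j).
    by apply: csum_fin => i ij; rewrite /u leqNgt ij.
  rewrite (eq_bigr (fun i : 'I_j.+1 => a i * b (j - i)%N)) // => i _.
  by rewrite /u -ltnS ltn_ord.
- by rewrite [la * _]mulrC; apply: csum_ext (csumZ lb ha) => i; rewrite mulrC.
Qed.

(** * The complex exponential and its power series *)

Definition cexp (z : C) : C :=
  (expR (complex.Re z) * cos (complex.Im z) +i* (expR (complex.Re z) * sin (complex.Im z)))%C.

Lemma cexpD x y : cexp (x + y) = cexp x * cexp y.
Proof.
case: x y => a b [c d]; rewrite /cexp /= expRD cosD sinD.
by apply/eqP; rewrite eq_complex /=; apply/andP; split; apply/eqP; ring.
Qed.

Lemma cexp0 : cexp 0 = 1.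
Proof. by rewrite /cexp /= expR0 cos0 sin0 mulr1 mulr0. Qed.

Lemma cabs_cexp z : cabs (cexp z) = expR (complex.Re z).
Proof.
by rewrite /cabs /= !exprMn -mulrDr cos2Dsin2 mulr1 sqrtr_sqr ger0_norm.
Qed.

Lemma cexp_neq0 z : cexp z != 0.
Proof. by rewrite -cabs_gt0 cabs_cexp expR_gt0. Qed.

Lemma cexp_real (a : R) : cexp a%:C%C = (expR a)%:C%C.
Proof. by rewrite /cexp /= cos0 sin0 mulr1 mulr0. Qed.

Definition expt (z : C) (n : nat) : C := z ^+ n / n`!%:R.

Lemma cabs_expt z n : cabs (expt z n) = exp_coeff (cabs z) n.
Proof. by rewrite /expt cabsM cabsV cabsX cabs_nat. Qed.

Lemma sum_exp_coeff_le (x : R) n : 0 <= x -> \sum_(i < n) exp_coeff x i <= expR x.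
Proof.
move=> x0; have := @nondecreasing_cvgn_le R (series (exp_coeff x)).
rewrite -[expR x]/(lim (series (exp_coeff x) @ \oo)) => h.
have := h _ (is_cvg_series_exp_coeff x) n.
rewrite {2}/series /= big_mkord; apply => i j ij.
rewrite /series /= !big_mkord; apply: sum_le_widen => // k; exact: exp_coeff_ge0.
Qed.

(** The Cauchy product and the binomial theorem make the sum of the series multiplicative, so it is
    enough to treat the two axes, where the series of exp, cos and sin are known. *)
Lemma csum_cexp z : csum (expt z) (cexp z).
Proof.
have bnd x k : \sum_(i < k) cabs (expt x i) <= expR (cabs x).
  by under eq_bigr do rewrite cabs_expt; apply: sum_exp_coeff_le; exact: cabs_ge0.
have key x y lx ly : csum (expt x) lx -> csum (expt y) ly ->
    csum (expt (x + y)) (lx * ly).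
  move=> hx hy; apply: csum_ext (csum_cauchy (bnd x) (bnd y) hx hy) => n.
  rewrite /expt addrC exprDn mulr_suml; apply: eq_bigr => -[i /=]; rewrite ltnS => ni _.
  rewrite -(bin_fact ni) -mulr_natr !natrM -[_ *+ _]mulr_natr.
  have h1 : (i`!%:R : C) != 0 by rewrite pnatr_eq0 -lt0n fact_gt0.
  have h2 : ((n - i)`!%:R : C) != 0 by rewrite pnatr_eq0 -lt0n fact_gt0.
  have h3 : ('C(n, i)%:R : C) != 0 by rewrite pnatr_eq0 -lt0n bin_gt0.
  by field; rewrite h1 h2 h3.
have hre (a : R) : csum (expt a%:C%C) (cexp a%:C%C).
  have hE n : expt a%:C%C n = (exp_coeff a n)%:C%C.
    by rewrite /expt /exp_coeff /= rmorphM rmorphXn fmorphV rmorph_nat.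
  rewrite cexp_real; apply: csum_complex.
    under eq_fun do rewrite hE /=; exact: is_cvg_series_exp_coeff.
  under eq_fun do rewrite hE /=.
  by apply: cvg_near_cst; near=> n; rewrite /series /= big1.
(* Splitting i^n by the parity of n makes the even terms the cosine series and the odd ones the sine
   series. *)
have him (b : R) : csum (expt ('i%C * b%:C%C)) (cexp ('i%C * b%:C%C)).
  have hI : ('i%C : C) ^+ 2 = -1 by exact: sqr_i.
  have hE n : expt ('i%C * b%:C%C) n = (cos_coeff b n +i* sin_coeff b n)%C.
    rewrite /expt exprMn -{1}(odd_double_half n) exprD -muln2 mulnC exprM hI.
    have -> : ((-1) ^+ n./2 : C) = ((-1) ^+ n./2)%:C%C by rewrite rmorphXn rmorphN1.
    rewrite -(rmorph_nat (real_complex R)) -fmorphV -rmorphXn /cos_coeff /sin_coeff /=.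
    case on : (odd n) => /=; rewrite ?expr0 ?expr1.
      apply/eqP; rewrite eq_complex /=; apply/andP; split; apply/eqP; rewrite ?mul0r; try ring.
      rewrite (_ : n.-1./2 = n./2); last by lia.
      ring.
    apply/eqP; rewrite eq_complex /=; apply/andP; split; apply/eqP; rewrite -?exprnP; ring.
  have -> : cexp ('i%C * b%:C%C) = (cos b +i* sin b)%C.
    by rewrite /cexp /= !(mul0r, mulr0, mul1r, mulr1, addr0, add0r, subr0, oppr0) expR0 !mul1r.
  apply: csum_complex.
    under eq_fun do rewrite hE /=; rewrite unlock; exact: is_cvg_series_cos_coeff.
  under eq_fun do rewrite hE /=; rewrite unlock; exact: is_cvg_series_sin_coeff.
rewrite {2}(complexE z) cexpD {1}(complexE z); exact: key (hre _) (him _).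
Unshelve. all: by end_near. Qed.

End Cauchy.

(** * Absolutely convergent power series on a disc *)

Section Wiener.
Variable R : realType.
Local Notation C := R[i].
Implicit Types (f g : C -> C) (p z : C) (r B : R) (c : nat -> C).

(** The Wiener algebra of a closed disc. [B] is only an upper bound of the l^1 norm, so that a
    majorant can be carried through each operation without computing norms. *)
Definition wiener f p r B : Prop := 0 <= r /\ exists2 c : nat -> C,
  (forall n, \sum_(j < n) cabs (c j) * r ^+ j <= B) &
  forall z, cabs (z - p) <= r -> csum (fun j => c j * (z - p) ^+ j) (f z).

Lemma wiener_ge0 f p r B : wiener f p r B -> 0 <= B.
Proof. by case=> _ [c /(_ 0%N)]; rewrite big_ord0. Qed.

Lemma wiener_terms c p r B z n : (forall n, \sum_(j < n) cabs (c j) * r ^+ j <= B) ->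
  cabs (z - p) <= r -> \sum_(j < n) cabs (c j * (z - p) ^+ j) <= B.
Proof.
move=> hB hz; apply: le_trans (hB n); apply: ler_sum => j _.
rewrite cabsM cabsX ler_wpM2l ?cabs_ge0 // lerXn2r ?nnegrE ?cabs_ge0 //.
exact: le_trans (cabs_ge0 _) hz.
Qed.

Lemma wiener_bound f p r B z : wiener f p r B -> cabs (z - p) <= r -> cabs (f z) <= B.
Proof.
move=> [r0 [c hB hc]] hz; apply: csum_le (hc _ hz) => n.
exact: le_trans (cabs_sum _ _ _) (wiener_terms _ hB hz).
Qed.

Lemma wiener_weaken f p r r' B B' : 0 <= r' -> r' <= r -> B <= B' ->
  wiener f p r B -> wiener f p r' B'.
Proof.
move=> r0 rr BB [_ [c hB hc]]; split=> //; exists c; last first.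
  by move=> z hz; apply: hc; exact: le_trans rr.
move=> n; apply: le_trans BB; apply: le_trans (hB n); apply: ler_sum => j _.
by rewrite ler_wpM2l ?cabs_ge0 // lerXn2r ?nnegrE // (le_trans r0).
Qed.

Lemma wiener_ext f g p r B : (forall z, cabs (z - p) <= r -> f z = g z) ->
  wiener f p r B -> wiener g p r B.
Proof.
by move=> h [r0 [c hB hc]]; split=> //; exists c => // z hz; rewrite -h //; exact: hc.
Qed.

Lemma wienerZ a f p r B : wiener f p r B -> wiener (fun z => a * f z) p r (cabs a * B).
Proof.
move=> [r0 [c hB hc]]; split=> //; exists (fun j => a * c j) => [n|z hz].
  under eq_bigr do rewrite cabsM -mulrA.
  by rewrite -mulr_sumr ler_wpM2l ?cabs_ge0.
by apply: csum_ext (csumZ a (hc z hz)) => j; rewrite mulrA.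
Qed.

Lemma wienerN f p r B : wiener f p r B -> wiener (fun z => - f z) p r B.
Proof.
move=> /(wienerZ (-1)); rewrite cabsN cabs1 mul1r; apply: wiener_ext => z _.
by rewrite mulN1r.
Qed.

Lemma wiener_cst a p r : 0 <= r -> wiener (fun=> a) p r (cabs a).
Proof.
split=> //; exists (fun j => if j is 0%N then a else 0) => [[|n]|z _].
- by rewrite big_ord0 cabs_ge0.
- rewrite big_ord_recl /= expr0 mulr1 big1 ?addr0 // => i _.
  by rewrite /= cabs0 mul0r.
- have := @csum_fin _ (fun j => (if j is 0%N then a else 0) * (z - p) ^+ j) 1%N.
  rewrite big_ord_recl big_ord0 /= expr0 mulr1 addr0; apply => -[//|i] _.
  by rewrite mul0r.
Qed.

Lemma wiener_center p r : 0 <= r -> wiener (fun z => z - p) p r r.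
Proof.
move=> r0; split=> //; exists (fun j => (j == 1%N)%:R) => [[|[|n]]|z _].
- by rewrite big_ord0.
- by rewrite big_ord_recl big_ord0 /= cabs0 mul0r addr0.
- rewrite 2!big_ord_recl /= cabs0 cabs1 mul0r mul1r expr1 add0r big1 ?addr0 // => i _.
  by rewrite mul0r.
- have := @csum_fin _ (fun j => (j == 1%N)%:R * (z - p) ^+ j) 2%N.
  rewrite 2!big_ord_recl big_ord0 /= mul0r add0r mul1r expr1 addr0; apply=> i i2.
  by rewrite gtn_eqF // mul0r.
Qed.

Lemma wienerD f g p r B B' : wiener f p r B -> wiener g p r B' ->
  wiener (fun z => f z + g z) p r (B + B').
Proof.
move=> [r0 [c hB hc]] [_ [c' hB' hc']]; split=> //.
exists (fun j => c j + c' j) => [n|z hz].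
  apply: le_trans (lerD (hB n) (hB' n)); rewrite -big_split /=.
  by apply: ler_sum => j _; rewrite -mulrDl ler_wpM2r ?exprn_ge0 ?cabsD.
by apply: csum_ext (csumD (hc z hz) (hc' z hz)) => j; rewrite mulrDl.
Qed.

(** The coefficients of degree < n of the product only involve the triangle i + j < n of products of
    coefficients, whose weighted moduli sum to at most [B * B']. *)
Lemma wienerM f g p r B B' : wiener f p r B -> wiener g p r B' ->
  wiener (fun z => f z * g z) p r (B * B').
Proof.
move=> [r0 [c hB hc]] [_ [c' hB' hc']]; split=> //.
have t0 (d : nat -> C) j : 0 <= cabs (d j) * r ^+ j by rewrite mulr_ge0 ?cabs_ge0 ?exprn_ge0.
exists (fun n => \sum_(i < n.+1) c i * c' (n - i)%N) => [n|z hz].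
  apply: le_trans (cauchy_double_le n n (t0 c) (t0 c') hB hB').
  rewrite exchange_big /=; apply: ler_sum => j _.
  apply: le_trans (ler_wpM2r (exprn_ge0 _ r0) (cabs_sum _ _ _)) _.
  rewrite mulr_suml.
  pose F i := if (i <= j)%N then
    cabs (c i) * r ^+ i * (cabs (c' (j - i)%N) * r ^+ (j - i)) else 0.
  have hF i : 0 <= F i by rewrite /F; case: ifP => // _; rewrite mulr_ge0.
  apply: le_trans (sum_le_widen hF (ltn_ord j)); apply: ler_sum => -[i /= ij] _.
  rewrite ltnS in ij; rewrite /F ij cabsM mulrACA -exprD subnKC //.
apply: csum_ext (csum_cauchy (fun n => wiener_terms n hB hz)
  (fun n => wiener_terms n hB' hz) (hc z hz) (hc' z hz)) => n.
rewrite mulr_suml; apply: eq_bigr => -[i /= ij] _; rewrite ltnS in ij.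
by rewrite mulrACA -exprD subnKC.
Qed.

Lemma wienerX f p r B n : wiener f p r B -> wiener (fun z => f z ^+ n) p r (B ^+ n).
Proof.
move=> h; elim: n => [|n IH].
  by have := wiener_cst 1 p (proj1 h); rewrite cabs1 expr0; apply: wiener_ext => z _; rewrite expr0.
by have := wienerM h IH; rewrite -exprS; apply: wiener_ext => z _; rewrite exprS.
Qed.

Lemma wiener_sum (I : Type) (s : seq I) (f : I -> C -> C) p r (B : I -> R) : 0 <= r ->
  (forall i, wiener (f i) p r (B i)) ->
  wiener (fun z => \sum_(i <- s) f i z) p r (\sum_(i <- s) B i).
Proof.
move=> r0 h; elim: s => [|i s IH].
  have := wiener_cst 0 p r0; rewrite cabs0 big_nil; apply: wiener_ext => z _.
  by rewrite big_nil.
by rewrite big_cons; apply: wiener_ext (wienerD (h i) IH) => z _; rewrite big_cons.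
Qed.

(** With [m] fixed, a single N makes all [m] partial sums close to their limits, so the bound
    survives the passage to the limit. It transfers norm bounds from partial sums of functions to
    the sum. *)
Lemma csum_sum_cabs_le m (u : nat -> nat -> C) (l : nat -> C) B :
  (forall j, csum (u j) (l j)) ->
  (forall n, \sum_(j < m) cabs (\sum_(i < n) u j i) <= B) ->
  \sum_(j < m) cabs (l j) <= B.
Proof.
move=> hu hB; apply/ler_addgt0Pr => e e0.
have [N hN] : exists N, forall n, (N <= n)%N ->
    \sum_(j < m) cabs (\sum_(i < n) u j i - l j) <= e.
  elim: m {hB} e e0 => [|m IH] e e0; first by exists 0%N => n _; rewrite big_ord0 ltW.
  have e2 : 0 < e / 2 by rewrite divr_gt0.
  have [N hN] := IH _ e2; have [N' hN'] := hu m _ e2; exists (maxn N N') => n.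
  rewrite geq_max => /andP[/hN {}hN /hN' {}hN']; rewrite big_ord_recr /=; lra.
apply: le_trans (lerD (hB N) (hN N (leqnn N))); rewrite -big_split /=.
apply: ler_sum => j _; set s := \sum_(i < N) _.
have {1}-> : l j = s - (s - l j) by ring.
by apply: le_trans (cabsD _ _) _; rewrite cabsN.
Qed.

(* The coefficients of the limit are the sums of the coefficients because the
   double series converges absolutely. *)
Lemma wiener_csum (f : nat -> C -> C) F p r (b : nat -> R) B : 0 < r ->
  (forall n, wiener (f n) p r (b n)) -> (forall n, \sum_(i < n) b i <= B) ->
  (forall z, cabs (z - p) <= r -> csum (f^~ z) (F z)) -> wiener F p r B.
Proof.
move=> r0 hf hB hF; split; first exact: ltW.
have /choice [c hc] : forall n, exists c : nat -> C,
    (forall k, \sum_(j < k) cabs (c j) * r ^+ j <= b n) /\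
    forall z, cabs (z - p) <= r -> csum (fun j => c j * (z - p) ^+ j) (f n z).
  by move=> n; have [_ [c h1 h2]] := hf n; exists c.
have dbl n m : \sum_(i < n) \sum_(j < m) cabs (c i j) * r ^+ j <= B.
  by apply: le_trans (hB n); apply: ler_sum => i _; have [] := hc i.
have rj j : 0 < r ^+ j by rewrite exprn_gt0.
(* Column [j] is dominated by the double sum; dividing by [r ^+ j], which is positive, shows that it
   converges absolutely. *)
have /choice [d hd] : forall j, exists d : C, csum (c^~ j) d.
  move=> j; have [|l hl _] := @csum_ex _ (c^~ j) (B / r ^+ j); last by exists l.
  move=> n; rewrite ler_pdivlMr // mulr_suml; apply: le_trans (dbl n j.+1).
  apply: ler_sum => i _; rewrite big_ord_recr /= lerDr sumr_ge0 // => k _.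
  by rewrite mulr_ge0 ?cabs_ge0 // ltW.
exists d => [m|z hz].
  have -> : \sum_(j < m) cabs (d j) * r ^+ j = \sum_(j < m) cabs ((r ^+ j)%:C%C * d j).
    by apply: eq_bigr => j _; rewrite cabsM cabs_real ger0_norm ?ltW // mulrC.
  apply: (@csum_sum_cabs_le m (fun j i => (r ^+ j)%:C%C * c i j)
    (fun j => (r ^+ j)%:C%C * d j)) => [j|n].
    exact: csumZ (hd j).
  apply: le_trans (dbl n m); rewrite exchange_big /=; apply: ler_sum => j _.
  apply: le_trans (cabs_sum _ _ _) _; apply: ler_sum => i _.
  by rewrite cabsM cabs_real ger0_norm ?(ltW (rj j)) // mulrC.
apply: (@csum_fubini _ (fun i j => c i j * (z - p) ^+ j) (f^~ z) _ B (F z)).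
- move=> n m; apply: le_trans (hB n); apply: ler_sum => i _.
  have [h _] := hc i; exact: wiener_terms h hz.
- by move=> i; have [_] := hc i; apply.
- by move=> j; rewrite mulrC; apply: csum_ext (csumZ _ (hd j)) => i; rewrite mulrC.
- exact: hF.
Qed.

(** Since n! <= (n + K)!, the term of order n + K has norm at most [B ^+ K] times the n-th term of
    the series of [expR B]. The factor [B ^+ K] is what later gives the remainders their order. *)
Lemma wiener_cexp_tail g p r B K : 0 < r -> wiener g p r B ->
  wiener (fun z => cexp (g z) - \sum_(k < K) expt (g z) k) p r (B ^+ K * expR B).
Proof.
move=> r0 h; have B0 := wiener_ge0 h.
apply: (@wiener_csum (fun n z => expt (g z) (n + K)) _ _ _
   (fun n => B ^+ K * exp_coeff B n)) => //.
- move=> n; apply: (@wiener_ext (fun z => (n + K)`!%:R^-1 * g z ^+ (n + K))).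
    by move=> z _; rewrite mulrC.
  apply: wiener_weaken (wienerZ ((n + K)`!%:R^-1) (wienerX (n + K) h)) => //.
  + exact: ltW.
  + rewrite cabsV cabs_nat exprD /exp_coeff /=.
    have -> (x y z : R) : x * (y * z) = z * (y * x) by ring.
    rewrite ler_wpM2l ?exprn_ge0 //.
    rewrite ler_wpM2l ?exprn_ge0 // lef_pV2 ?posrE ?ltr0n ?fact_gt0 //.
    by rewrite ler_nat; exact: (leq_fact (leq_addr _ _)).
- by move=> n; rewrite -mulr_sumr ler_wpM2l ?exprn_ge0 // sum_exp_coeff_le.
- by move=> z _; apply: csum_drop; exact: csum_cexp.
Qed.

Lemma wiener_cexp g p r B : 0 < r -> wiener g p r B ->
  wiener (fun z => cexp (g z)) p r (expR B).
Proof.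
move=> r0 h; have := wiener_cexp_tail 0 r0 h; rewrite expr0 mul1r.
by apply: wiener_ext => z _; rewrite big_ord0 subr0.
Qed.

Lemma wiener_shift f p r B s : wiener f (p + s) r B -> wiener (fun z => f (z + s)) p r B.
Proof.
move=> [r0 [c hB hc]]; split=> //; exists c => // z hz.
have e : z + s - (p + s) = z - p by ring.
by have := hc (z + s); rewrite e; apply.
Qed.

(* 1 / (z - q) = \sum_n (-1)^n (z - p)^n / (p - q)^n.+1 *)
Lemma wiener_inv p q r : 0 < r -> r < cabs (p - q) ->
  exists B, wiener (fun z => (z - q)^-1) p r B.
Proof.
move=> r0 hr; pose x := r / cabs (p - q).
have n0 : 0 < cabs (p - q) by exact: lt_trans r0 hr.
have pq : p - q != 0 by rewrite -cabs_gt0.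
have x0 : 0 <= x by rewrite divr_ge0 // ltW.
have x1 : x < 1 by rewrite ltr_pdivrMr // mul1r.
exists ((cabs (p - q))^-1 * (1 - x)^-1); split; first exact: ltW.
exists (fun j => (p - q)^-1 * (- (p - q)^-1) ^+ j) => [n|z hz].
  under eq_bigr => j _ do
    rewrite cabsM cabsX cabsN !cabsV -mulrA -exprMn [_ * r]mulrC -/x.
  rewrite -mulr_sumr ler_wpM2l ?invr_ge0 ?cabs_ge0 //.
  rewrite -[leRHS]mul1r ler_pdivlMr ?subr_gt0 // mulrC.
  have := subrX1 x n; rewrite -(big_mkord xpredT (fun i => x ^+ i)) big_mkord => h.
  have xn : 0 <= x ^+ n by exact: exprn_ge0.
  lra.
set t := - (p - q)^-1 * (z - p).
have zq : z - q = (p - q) * (1 - t) by rewrite /t; field.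
have tx : cabs t <= x by rewrite cabsM cabsN cabsV mulrC ler_wpM2r ?invr_ge0 ?cabs_ge0.
have t1 : 1 - t != 0.
  apply/eqP => /subr0_eq e; move: tx; rewrite -e cabs1; lra.
apply: csum_ext (_ : csum (fun j => (p - q)^-1 * t ^+ j) _).
  by move=> j; rewrite /t exprMn mulrA.
rewrite zq invfM; apply: csumZ => e e0.
have /cvgrPdist_lt /(_ (e * (1 - x))) : (fun n => x ^+ n) @ \oo --> (0 : R).
  by apply: cvg_expr; rewrite ger0_norm.
case; first by rewrite mulr_gt0 ?subr_gt0.
move=> N _ hN; exists N => n /hN /=; rewrite sub0r normrN ger0_norm ?exprn_ge0 // => h.
have -> : \sum_(i < n) t ^+ i - (1 - t)^-1 = - (t ^+ n / (1 - t)).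
  apply: (mulIf t1); rewrite mulrBl mulVf // mulNr divfK // mulrC.
  by rewrite -[t ^+ n](subrK 1) subrX1; ring.
rewrite cabsN cabsM cabsV cabsX ltr_pdivrMr ?cabs_gt0 //.
have h1 : 1 - x <= cabs (1 - t).
  by have := cabsD (1 - t) t; rewrite subrK cabs1; lra.
apply: le_lt_trans (_ : x ^+ n < _); first by rewrite lerXn2r ?nnegrE ?cabs_ge0.
by apply: lt_le_trans h _; rewrite ler_wpM2l // ltW.
Qed.

End Wiener.

(** * Taylor expansions and isolated zeros *)

Section Holomorphic.
Variable R : realType.
Local Notation C := R[i].
Implicit Types (f g h F : C -> C) (p q z : C) (r e B : R) (c : nat -> C).

Definition taylor h p c : Prop := exists2 e, 0 < e &
  forall z, cabs (z - p) < e -> csum (fun j => c j * (z - p) ^+ j) (h z).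

(** Abel's argument: convergence at one point at distance r0 from p bounds [cabs (c j) * r0 ^+ j] by
    some [A], so for the radius r0 / 2 the terms are dominated by A / 2^j, of total at most
    [A * 2]. *)
Lemma taylor_abs h p c : taylor h p c -> exists r B, [/\ 0 < r,
  forall n, \sum_(j < n) cabs (c j) * r ^+ j <= B &
  forall z, cabs (z - p) <= r -> csum (fun j => c j * (z - p) ^+ j) (h z)].
Proof.
move=> [e e0 he]; set r0 := e / 2; have r00 : 0 < r0 by rewrite divr_gt0.
have := he (p + r0%:C%C); rewrite (_ : p + _ - p = r0%:C%C); last by ring.
rewrite cabs_real ger0_norm ?(ltW r00) // => /(_ _) hs.
have [|N hN] := hs _ 1 ltr01; first by rewrite /r0; lra.
(* A term is the difference of two consecutive partial sums, both within 1 of the limit. *)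
have bd j : (N <= j)%N -> cabs (c j) * r0 ^+ j <= 2.
  move=> Nj; have h1 := hN j Nj; have := hN j.+1 (leqW Nj); rewrite big_ord_recr /=.
  set a := c j * _; set s := \sum_(i < j) _ in h1 *; set l := h _ in h1 *; move=> h2.
  have -> : cabs (c j) * r0 ^+ j = cabs a.
    by rewrite cabsM cabsX cabs_real ger0_norm // ltW.
  have -> : a = (s + a - l) - (s - l) by ring.
  by apply: le_trans (cabsD _ _) _; rewrite cabsN; lra.
set A := 2 + \sum_(j < N) cabs (c j) * r0 ^+ j.
have A0 : 0 <= \sum_(j < N) cabs (c j) * r0 ^+ j.
  by apply: sumr_ge0 => j _; rewrite mulr_ge0 ?cabs_ge0 // exprn_ge0 // ltW.
have bA j : cabs (c j) * r0 ^+ j <= A.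
  have [/bd|jN] := leqP N j; first by rewrite /A; lra.
  rewrite /A (bigD1 (Ordinal jN)) //= addrCA lerDl addr_ge0 // sumr_ge0 // => i _.
  by rewrite mulr_ge0 ?cabs_ge0 // exprn_ge0 // ltW.
exists (r0 / 2), (A * 2); split; first by rewrite divr_gt0.
  move=> n; apply: (@le_trans _ _ (\sum_(j < n) A * (2^-1) ^+ j)).
    apply: ler_sum => j _; rewrite exprMn mulrA ler_wpM2r ?exprn_ge0 //.
  rewrite -mulr_sumr ler_wpM2l ?addr_ge0 //.
  have := subrX1 (2^-1 : R) n => hh.
  have : 0 <= (2^-1 : R) ^+ n by rewrite exprn_ge0 // invr_ge0.
  lra.
by move=> z hz; apply: he; apply: le_lt_trans hz _; rewrite /r0; lra.
Qed.

Lemma taylorB f g p c c' : taylor f p c -> taylor g p c' ->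
  taylor (fun z => f z - g z) p (fun j => c j - c' j).
Proof.
move=> [e e0 he] [e' e'0 he']; exists (Num.min e e'); first by rewrite lt_min e0.
move=> z; rewrite lt_min => /andP[/he hz /he' /(csumZ (-1)) hz'].
rewrite -[- g z]mulN1r; apply: csum_ext (csumD hz hz') => j; ring.
Qed.

Lemma taylor_ext f g p c : (exists2 e, 0 < e & forall z, cabs (z - p) < e -> f z = g z) ->
  taylor f p c -> taylor g p c.
Proof.
move=> [e e0 he] [e' e'0 he']; exists (Num.min e e'); first by rewrite lt_min e0.
by move=> z; rewrite lt_min => /andP[/he <- /he'].
Qed.

Lemma taylor_shift f p c N : taylor f p c ->
  taylor (fun z => (z - p) ^+ N * f z) p (fun j => if (N <= j)%N then c (j - N)%N else 0).
Proof.
move=> [e e0 he]; exists e => // z /he /(csumZ ((z - p) ^+ N)) /(csum_shift N).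
apply: csum_ext => j; case: ifP => Nj; last by rewrite mul0r.
by rewrite mulrCA -exprD subnKC.
Qed.

Lemma taylor_at f p c : taylor f p c -> f p = c 0%N.
Proof.
move=> [e e0 /(_ p)]; rewrite subrr cabs0 => /(_ e0) h; apply: csum_uniq h _.
have := @csum_fin _ (fun j => c j * 0 ^+ j) 1%N.
rewrite big_ord_recl big_ord0 expr0 mulr1 addr0; apply => -[//|i] _.
by rewrite expr0n mulr0.
Qed.

(** If all coefficients before [c k] vanish, dividing the expansion at a zero z by (z - p)^k gives
    |c k| <= |z - p| B / r^(k + 1), and z can be taken arbitrarily close to p. *)
Lemma taylor_isolated f p c : taylor f p c ->
  (forall e, 0 < e -> exists z, [/\ z != p, cabs (z - p) < e & f z = 0]) ->
  forall j, c j = 0.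
Proof.
move=> /taylor_abs[r [B [r0 hB hc]]] hz k; elim/ltn_ind: k => k IH.
apply/eqP; rewrite -cabs_eq0; apply/eqP/le_anti; rewrite cabs_ge0 andbT.
have B0 : 0 <= B by have := hB 0%N; rewrite big_ord0.
set B' := B / r ^+ k.+1.
have B'0 : 0 <= B' by rewrite divr_ge0 // exprn_ge0 // ltW.
apply/ler_addgt0Pr => e e0; rewrite add0r.
have [|z [zp ze fz]] := hz (Num.min r (e / (B' + 1))).
  by rewrite lt_min r0 divr_gt0 // ltr_wpDl.
move: ze; rewrite lt_min => /andP[zr ze].
have zp' : z - p != 0 by rewrite subr_eq0.
have := hc z (ltW zr); rewrite fz => /(csum_drop k); rewrite sub0r.
rewrite big1 => [|i _]; last by rewrite IH ?mul0r.
move=> /(csumZ ((z - p) ^- k)); rewrite oppr0 mulr0 => /csum_recr.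
rewrite add0n sub0r mulrCA mulVf ?expf_neq0 // mulr1 => hs.
rewrite -cabsN; apply: (@le_trans _ _ (cabs (z - p) * B')); last first.
  apply: le_trans (_ : cabs (z - p) * (B' + 1) <= _).
    by rewrite ler_wpM2l ?cabs_ge0 // lerDl.
  by rewrite -ler_pdivlMr ?ltW // ltr_wpDl.
apply: csum_le hs => n; apply: le_trans (cabs_sum _ _ _) _.
have tj (j : nat) : 0 <= cabs (c j) * r ^+ j by rewrite mulr_ge0 ?cabs_ge0 // exprn_ge0 // ltW.
apply: (@le_trans _ _ (\sum_(i < n) cabs (z - p) / r ^+ k.+1 *
    (cabs (c (k.+1 + i)%N) * r ^+ (k.+1 + i)))).
  apply: ler_sum => i _; have -> : (k.+1 + i)%N = (i.+1 + k)%N by lia.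
  have -> : (z - p) ^- k * (c (i.+1 + k)%N * (z - p) ^+ (i.+1 + k)) =
      c (i.+1 + k)%N * (z - p) ^+ i.+1.
    by rewrite mulrCA exprD [_ ^- k * _]mulrCA mulVf ?expf_neq0 // mulr1.
  have -> : r ^+ (i.+1 + k) = r ^+ k.+1 * r ^+ i by rewrite -exprD; congr (_ ^+ _); lia.
  rewrite mulrCA -!mulrA [_ ^-1 * _]mulrA mulVf ?expf_neq0 ?gt_eqF // mul1r.
  rewrite cabsM cabsX exprS ler_wpM2l ?cabs_ge0 // ler_wpM2l ?cabs_ge0 //.
  by rewrite lerXn2r ?nnegrE ?cabs_ge0 // ltW.
have -> : cabs (z - p) * B' = cabs (z - p) / r ^+ k.+1 * B by rewrite /B' mulrA mulrAC.
rewrite -mulr_sumr ler_wpM2l ?divr_ge0 ?cabs_ge0 ?exprn_ge0 ?(ltW r0) //.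
apply: le_trans (hB (k.+1 + n)%N).
rewrite (sum_ord_split (fun j => cabs (c j) * r ^+ j) (leq_addr n k.+1)) addKn lerDr.
exact: sumr_ge0.
Qed.

End Holomorphic.

(** * Holomorphic and meromorphic functions; the identity theorem *)

Section Identity.
Variable R : realType.
Local Notation C := R[i].
Implicit Types (f g h F : C -> C) (p q z : C) (r e B s : R) (c : nat -> C).

(** Holomorphy is stated by an expansion of bounded norm so that sums, products and exponentials
    come directly from the norm estimates; [hol_analytic] identifies it with [analytic_at]. *)
Definition hol f p : Prop := exists r B, 0 < r /\ wiener f p r B.

Lemma hol_taylor f p : hol f p -> exists c, taylor f p c.
Proof.
move=> [r [B [r0 [_ [c hB hc]]]]]; exists c, r => // z /ltW; exact: hc.
Qed.

Lemma taylor_hol f p c : taylor f p c -> hol f p.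
Proof.
move=> /taylor_abs[r [B [r0 hB hc]]]; exists r, B; split=> //.
by split; [exact: ltW|exists c].
Qed.

Lemma taylor_analytic f p : (exists c, taylor f p c) <-> analytic_at f p.
Proof.
split=> -[c].
  move=> [e e0 he]; exists c; apply/nbhs_cabsP; exists e => // z /he hz.
  exact/csumP.
move=> /nbhs_cabsP[e e0 he]; exists c, e => // z /he hz; exact/csumP.
Qed.

Lemma hol_analytic f p : hol f p <-> analytic_at f p.
Proof.
rewrite -taylor_analytic; split; first exact: hol_taylor.
by case=> c /taylor_hol.
Qed.

Lemma hol_ext f g p :
  (exists2 e, 0 < e & forall z, cabs (z - p) < e -> f z = g z) -> hol f p -> hol g p.
Proof. by move=> h /hol_taylor[c hc]; apply: taylor_hol (taylor_ext h hc). Qed.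

Lemma hol_eq f g p : f =1 g -> hol f p -> hol g p.
Proof. by move=> /funext ->. Qed.

Lemma hol_cst a p : hol (fun=> a) p.
Proof. by exists 1, (cabs a); split; [exact: ltr01|exact: (wiener_cst _ _ ler01)]. Qed.

Lemma hol_center q p : hol (fun z => z - q) p.
Proof.
exists 1, (1 + cabs (p - q)); split; first exact: ltr01.
apply: wiener_ext (wienerD (wiener_center p ler01) (wiener_cst (p - q) p ler01)) => z _; ring.
Qed.

Lemma hol_common f g p : hol f p -> hol g p ->
  exists r B B', [/\ 0 < r, wiener f p r B & wiener g p r B'].
Proof.
move=> [r [B [r0 h]]] [r' [B' [r'0 h']]]; exists (Num.min r r'), B, B'; split.
- by rewrite lt_min r0.
- by apply: wiener_weaken h => //; rewrite ?le_min ?(ltW r0) ?(ltW r'0) // ge_min lexx.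
- by apply: wiener_weaken h' => //; rewrite ?le_min ?(ltW r0) ?(ltW r'0) // ge_min lexx orbT.
Qed.

Lemma holD f g p : hol f p -> hol g p -> hol (fun z => f z + g z) p.
Proof.
move=> hf hg; have [r [B [B' [r0 h h']]]] := hol_common hf hg.
by exists r, (B + B'); split=> //; exact: wienerD.
Qed.

Lemma holM f g p : hol f p -> hol g p -> hol (fun z => f z * g z) p.
Proof.
move=> hf hg; have [r [B [B' [r0 h h']]]] := hol_common hf hg.
by exists r, (B * B'); split=> //; exact: wienerM.
Qed.

Lemma holZ a f p : hol f p -> hol (fun z => a * f z) p.
Proof. exact: holM (hol_cst a p). Qed.

Lemma holN f p : hol f p -> hol (fun z => - f z) p.
Proof. by move=> /(holZ (-1)); apply: hol_eq => z; rewrite mulN1r. Qed.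

Lemma holB f g p : hol f p -> hol g p -> hol (fun z => f z - g z) p.
Proof. by move=> hf /holN; exact: holD. Qed.

Lemma holX f p n : hol f p -> hol (fun z => f z ^+ n) p.
Proof. by move=> [r [B [r0 h]]]; exists r, (B ^+ n); split=> //; exact: wienerX. Qed.

Lemma hol_sum (I : Type) (s : seq I) (P : pred I) (f : I -> C -> C) p :
  (forall i, P i -> hol (f i) p) -> hol (fun z => \sum_(i <- s | P i) f i z) p.
Proof.
move=> h; elim: s => [|i s IH].
  by apply: hol_eq (hol_cst 0 p) => z; rewrite big_nil.
have [Pi|Pi] := boolP (P i).
  by apply: hol_eq (holD (h i Pi) IH) => z; rewrite big_cons Pi.
by apply: hol_eq IH => z; rewrite big_cons (negbTE Pi).
Qed.

Lemma hol_prod (I : Type) (s : seq I) (f : I -> C -> C) p :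
  (forall i, hol (f i) p) -> hol (fun z => \prod_(i <- s) f i z) p.
Proof.
move=> h; elim: s => [|i s IH].
  by apply: hol_eq (hol_cst 1 p) => z; rewrite big_nil.
by apply: hol_eq (holM (h i) IH) => z; rewrite big_cons.
Qed.

Lemma hol_shift f p a : hol f (p + a) -> hol (fun z => f (z + a)) p.
Proof. by move=> [r [B [r0 /wiener_shift h]]]; exists r, B. Qed.

Lemma hol_inv p q : p != q -> hol (fun z => (z - q)^-1) p.
Proof.
move=> pq; have n0 : 0 < cabs (p - q) by rewrite cabs_gt0 subr_eq0.
have [||B hB] := @wiener_inv _ p q (cabs (p - q) / 2); [by rewrite divr_gt0| |].
  by rewrite ltr_pdivrMr // ltr_pMr // ltr1n.
by exists (cabs (p - q) / 2), B; split=> //; rewrite divr_gt0.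
Qed.

Lemma hol_cexp f p : hol f p -> hol (fun z => cexp (f z)) p.
Proof. by move=> [r [B [r0 h]]]; exists r, (expR B); split=> //; exact: wiener_cexp. Qed.

Lemma hol_isolated f p : hol f p ->
  (forall e, 0 < e -> exists z, [/\ z != p, cabs (z - p) < e & f z = 0]) ->
  exists2 e, 0 < e & forall z, cabs (z - p) < e -> f z = 0.
Proof.
move=> /hol_taylor[c hc] /(taylor_isolated hc) c0; case: hc => e e0 he.
exists e => // z /he hz; apply: csum_uniq hz _.
by apply: csum_ext (@csum0 R) => j; rewrite c0 mul0r.
Qed.

(** The centre is excluded because a meromorphic function has an arbitrary value at a pole. *)
Definition zero_near f p : Prop :=
  exists2 e, 0 < e & forall z, z != p -> cabs (z - p) < e -> f z = 0.

(** The points at distances e / 2 and e / 3 from [p] in the real direction cannot both equal [q]. *)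
Lemma pick_near p q e : 0 < e -> exists z, [/\ z != p, z != q & cabs (z - p) < e].
Proof.
move=> e0; pose u (t : R) := p + (e * t)%:C%C.
have u0 t : u t - p = (e * t)%:C%C by rewrite /u; ring.
have [] := eqVneq (u (2^-1)) q => uq; last first.
  exists (u 2^-1); rewrite uq u0 cabs_real -subr_eq0 u0 -cabs_gt0 cabs_real.
  by split=> //; rewrite ger0_norm; lra.
have h t : u t != p = (e * t != 0).
  by rewrite -subr_eq0 u0 -cabs_eq0 cabs_real normr_eq0.
exists (u 3^-1); rewrite h -uq u0 cabs_real -(subr_eq0 (u _)).
rewrite (_ : u _ - u _ = (e * (3^-1 - 2^-1))%:C%C); last by rewrite /u; ring.
rewrite -cabs_eq0 cabs_real normr_eq0 ger0_norm; last by lra.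
by split; [apply/eqP; lra|apply/eqP; lra|lra].
Qed.

Lemma hol_zero_near f p : hol f p -> zero_near f p ->
  exists2 e, 0 < e & forall z, cabs (z - p) < e -> f z = 0.
Proof.
move=> hf [e e0 he]; apply: hol_isolated hf _ => e' e'0.
have [|z [zp _ ze]] := @pick_near p p (Num.min e e'); first by rewrite lt_min e0.
by move: ze; rewrite lt_min => /andP[ze ze']; exists z; rewrite he.
Qed.

(** Weaker than [meromorphic] at a point: [N] need not be minimal and the value at [p] is free,
    which makes the notion stable under subtraction. *)
Definition meromorphic_at f p : Prop := exists N h, hol h p /\
  exists2 e, 0 < e & forall z, z != p -> cabs (z - p) < e -> (z - p) ^+ N * f z = h z.

Lemma hol_meromorphic_at f p : hol f p -> meromorphic_at f p.
Proof.
by move=> hf; exists 0%N, f; split=> //; exists 1 => [|z _ _]; rewrite ?ltr01 ?expr0 ?mul1r.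
Qed.

Lemma meromorphic_atB f g p : meromorphic_at f p -> meromorphic_at g p -> meromorphic_at (fun z => f z - g z) p.
Proof.
move=> [N [h [hh [e e0 he]]]] [N' [h' [hh' [e' e'0 he']]]].
exists (N + N')%N, (fun z => (z - p) ^+ N' * h z - (z - p) ^+ N * h' z); split.
  by apply: holB; apply: holM => //; apply: holX; exact: hol_center.
exists (Num.min e e'); first by rewrite lt_min e0.
move=> z zp; rewrite lt_min => /andP[/he <- // /he' <- //].
by rewrite exprD; ring.
Qed.

Lemma meromorphic_at_isolated f p : meromorphic_at f p ->
  (forall e, 0 < e -> exists z, [/\ z != p, cabs (z - p) < e & f z = 0]) ->
  zero_near f p.
Proof.
move=> [N [h [hh [e e0 he]]]] hz; have [|e' e'0 he'] := hol_isolated hh _.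
  move=> e' e'0; have [|z [zp]] := hz (Num.min e e'); first by rewrite lt_min e0.
  rewrite lt_min => /andP[ze ze'] fz; exists z; split=> //.
  by rewrite -he // fz mulr0.
exists (Num.min e e'); first by rewrite lt_min e0.
move=> z zp; rewrite lt_min => /andP[/he h1 /he' h2]; apply/eqP.
have := h1 zp; rewrite h2 => /eqP; rewrite mulf_eq0 => /orP[|//].
by rewrite expf_eq0 subr_eq0 (negbTE zp) andbF.
Qed.

(* Identity theorem: the set of t for which G vanishes around q0 + s (q1 - q0)
   for all s <= t is closed because zeros of G are isolated. *)
Lemma identity_segment G q0 q1 :
  (forall t : R, 0 <= t <= 1 -> meromorphic_at G (q0 + t%:C%C * (q1 - q0))) ->
  zero_near G q0 -> zero_near G q1.
Proof.
(* The added 1 keeps the Lipschitz constant [L] of [P] positive even when [q0 = q1]. *)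
move=> hG h0; pose P (t : R) := q0 + t%:C%C * (q1 - q0); pose L := cabs (q1 - q0) + 1.
have L0 : 0 < L by rewrite ltr_wpDl ?cabs_ge0.
have Pd t t' : cabs (P t - P t') <= `|t - t'| * L.
  rewrite (_ : P t - P t' = (t - t')%:C%C * (q1 - q0)); last by rewrite /P; ring.
  by rewrite cabsM cabs_real ler_wpM2l // lerDl.
pose S := [set t : R | 0 <= t <= 1 /\ forall s, 0 <= s <= t -> zero_near G (P s)].
have S0 : S 0.
  split; first by rewrite lexx ler01.
  by move=> s hs; rewrite (_ : s = 0) /P ?mul0r ?addr0 //; lra.
have hS : has_sup S by split; [exists 0|exists 1 => t [/andP[]]].
set tau := sup S.
have tau0 : 0 <= tau by apply: ub_le_sup => //; case: hS.
have tau1 : tau <= 1 by apply: ge_sup => [|t [/andP[]]//]; exists 0.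
have Zlt s : 0 <= s -> s < tau -> zero_near G (P s).
  move=> s0 st; have [|t [_ ht] h] := @sup_adherent _ S (tau - s) _ hS.
    by rewrite subr_gt0.
  by apply: ht; rewrite -/tau in h; lra.
have Ztau : zero_near G (P tau).
  have [t0|t0] := eqVneq tau 0; first by rewrite t0; apply S0.2; rewrite lexx.
  apply: meromorphic_at_isolated; first by apply: hG; rewrite tau0.
  (* [G] vanishes around the point of parameter [tau - dl / 2], hence at some point other than
     [P tau] within [e] of it: zeros accumulate at [P tau]. *)
  move=> e e0; set dl := Num.min tau (e / L / 2).
  have tp : 0 < tau by rewrite lt_def t0.
  have dl0 : 0 < dl by rewrite lt_min tp !divr_gt0.
  have dl1 : dl <= tau by rewrite ge_min lexx.
  have dl2 : dl <= e / L / 2 by rewrite ge_min lexx orbT.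
  have [||e' e'0 he'] := Zlt (tau - dl / 2); [lra|lra|].
  have [|z [zp zt ze]] := @pick_near (P (tau - dl / 2)) (P tau) (Num.min e' (e / 2)).
    by rewrite lt_min e'0 divr_gt0.
  move: ze; rewrite lt_min => /andP[ze' ze]; exists z; split=> //; last exact: he'.
  rewrite (_ : z - P tau = (z - P (tau - dl / 2)) + (P (tau - dl / 2) - P tau)); last by ring.
  apply: le_lt_trans (cabsD _ _) _; have := Pd (tau - dl / 2) tau.
  rewrite (_ : _ - _ - _ = - (dl / 2)); last by ring.
  rewrite normrN ger0_norm; last lra.
  have : dl / 2 * L <= e / 2 / 2.
    apply: le_trans (_ : e / L / 2 / 2 * L <= _); last first.
      by rewrite (_ : _ * L = e / 2 / 2) //; field; rewrite gt_eqF.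
    by rewrite ler_wpM2r ?(ltW L0) // ler_wpM2r // invr_ge0.
  lra.
have q1E : q1 = P 1 by rewrite /P; ring.
have [t1|t1] := eqVneq tau 1; first by rewrite q1E -t1.
(* If [tau < 1], the punctured disc around [P tau] on which [G] vanishes also settles the next
   points of the segment, against the choice of [tau] as a supremum. *)
have [e e0 he] := Ztau; pose dl := Num.min (1 - tau) (e / L / 2).
have dl0 : 0 < dl by rewrite lt_min subr_gt0 lt_def eq_sym t1 tau1 !divr_gt0.
have dl1 : dl <= 1 - tau by rewrite ge_min lexx.
have dl2 : dl <= e / L / 2 by rewrite ge_min lexx orbT.
suff : S (tau + dl).
  move=> h; have : tau + dl <= tau by apply: ub_le_sup => //; case: hS.
  lra.
split; first lra.
move=> s hs; have [st|ts] := ltP s tau; first by apply: Zlt => //; lra.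
have hst : cabs (P s - P tau) <= e / 2.
  apply: le_trans (Pd _ _) _; rewrite ger0_norm ?subr_ge0 //.
  apply: le_trans (_ : e / L / 2 * L <= _); last first.
    by rewrite (_ : _ * L = e / 2) //; field; rewrite gt_eqF.
  by rewrite ler_wpM2r ?(ltW L0) //; lra.
have [->//|sneq] := eqVneq (P s) (P tau).
have n0 : 0 < cabs (P s - P tau) by rewrite cabs_gt0 subr_eq0.
(* The radius is at most the distance to [P tau], the one point where [G] is not known to vanish. *)
exists (Num.min (cabs (P s - P tau)) (e / 2)); first by rewrite lt_min n0 divr_gt0.
move=> z zs; rewrite lt_min => /andP[h1 h2]; apply: he.
  by apply/eqP => zE; rewrite zE cabsB ltxx in h1.
rewrite (_ : z - P tau = (z - P s) + (P s - P tau)); last by ring.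
apply: le_lt_trans (cabsD _ _) _; lra.
Qed.

Lemma zero_near_open G p : (exists2 e, 0 < e & forall z, cabs (z - p) < e -> G z = 0) ->
  zero_near G p.
Proof. by move=> [e e0 he]; exists e => // z _; exact: he. Qed.

(** The segment from [p] to a real point beyond both bounds stays in the convex half-plane Re z > s;
    the added 1 makes the unit disc around that point lie in Re z > s', where f = g. *)
Lemma hol_eq_halfplane f g s s' : 
  (forall p, s < complex.Re p -> hol f p) -> (forall p, s < complex.Re p -> hol g p) ->
  (forall z, s' < complex.Re z -> f z = g z) ->
  forall z, s < complex.Re z -> f z = g z.
Proof.
move=> hf hg hfg p ps.
pose q0 : C := (Num.max s s' + 1)%:C%C.
have mx1 : s <= Num.max s s' by rewrite le_max lexx.
have mx2 : s' <= Num.max s s' by rewrite le_max lexx orbT.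
have : zero_near (fun z => f z - g z) p.
  apply: (@identity_segment _ q0) => [t /andP[t0 t1]|].
    suff : s < complex.Re (q0 + t%:C%C * (p - q0)).
      by move=> h; apply: hol_meromorphic_at; apply: holB; [exact: hf|exact: hg].
    rewrite /q0; case: p ps => a b /= sa; rewrite !mul0r !subr0.
    set M := Num.max _ _ in mx1 mx2 *.
    have h1 : 0 <= (1 - t) * (M + 1 - s) by apply: mulr_ge0; lra.
    have h2 : 0 <= t * (a - s) by apply: mulr_ge0; lra.
    have [t0'|tn] := eqVneq t 0; first by rewrite t0'; lra.
    have h3 : 0 < t * (a - s) by apply: mulr_gt0; rewrite ?subr_gt0 // lt_def tn.
    lra.
  apply: zero_near_open; exists 1 => [|z hz]; first exact: ltr01.
  rewrite hfg ?subrr //; have := cabs_Re (z - q0).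
  case: z hz => a b hz /= h; have := le_lt_trans h hz; rewrite ltr_norml; lra.
move=> /(hol_zero_near (holB (hf _ ps) (hg _ ps)))[e e0 /(_ p)].
by rewrite subrr cabs0 => /(_ e0)/subr0_eq.
Qed.

End Identity.

(** * The binomial series and the norm of its remainder *)

Section Binomial.
Variable R : realType.
Local Notation C := R[i].
Implicit Types (s p z : C) (lam r B : R).

Definition binc s k : C := (\prod_(j < k) (s - j%:R)) / k`!%:R.

Lemma binc0 s : binc s 0 = 1.
Proof. by rewrite /binc big_ord0 fact0 divr1. Qed.

Lemma bincS s k : binc s k.+1 = binc s k * (s - k%:R) / k.+1%:R.
Proof.
rewrite /binc big_ord_recr /= factS natrM invfM; ring.
Qed.

Lemma binc_0S k : binc 0 k.+1 = 0.
Proof. by rewrite /binc big_ord_recl /= subrr !mul0r. Qed.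

Lemma binc_nat n k : binc n%:R k = 'C(n, k)%:R.
Proof.
rewrite /binc.
have -> : \prod_(j < k) (n%:R - j%:R : C) = (n ^_ k)%:R.
  elim: k => [|k IH]; first by rewrite big_ord0 ffactn0.
  rewrite big_ord_recr /= IH ffactnSr natrM; have [kn|nk] := leqP k n.
    by rewrite natrB.
  by rewrite ffact_small // !mul0r.
by rewrite -bin_ffact natrM mulfK // pnatr_eq0 -lt0n fact_gt0.
Qed.

Definition cexp_tail K (z : C) : C := cexp z - \sum_(k < K) expt z k.

(** The Lagrange basis polynomials of the nodes 0, ..., K - 1. *)
Definition lagr K (i : nat) : {poly C} :=
  \prod_(j < K | (j : nat) != i) ((i%:R - j%:R)^-1 *: ('X - (j%:R)%:P)).

(** The difference of the two sides has size at most [K] and the [K] distinct roots 0, ..., K - 1,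
    so it is zero. *)
Lemma interpolation K (q : {poly C}) s : (size q <= K)%N ->
  q.[s] = \sum_(i < K) q.[i%:R] * (lagr K i).[s].
Proof.
move=> sq; pose d := q - \sum_(i < K) q.[i%:R] *: lagr K i.
have lE (i k : 'I_K) : (lagr K i).[k%:R] = (i == k)%:R.
  rewrite /lagr horner_prod; have [<-|ik] := eqVneq i k.
    rewrite big1 // => j ji; rewrite hornerZ hornerXsubC mulVf //.
    by rewrite subr_eq0 eqr_nat eq_sym.
  rewrite (bigD1 k) /=; last by rewrite eq_sym.
  by rewrite hornerZ hornerXsubC subrr mulr0 mul0r.
have sl (i : 'I_K) : (size (lagr K i) <= K)%N.
  apply: leq_trans (size_prod_leq _ _) _.
  have := @cardC1 'I_K i; rewrite card_ord => cK.
  have h : (\sum_(j < K | (j : nat) != i) size ((i%:R - j%:R : C)^-1 *: ('X - (j%:R)%:P))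
      <= \sum_(j < K | (j : nat) != i) 2)%N.
    by apply: leq_sum => j _; apply: leq_trans (size_scale_leq _ _) _; rewrite size_XsubC.
  rewrite sum_nat_const in h.
  have e : #|[pred j : 'I_K | (j : nat) != i]| = K.-1 by rewrite -cK; apply: eq_card.
  rewrite e in h *; apply: (@leq_trans ((K.-1 * 2).+1 - K.-1)).
    by apply: leq_sub2r; rewrite ltnS.
  have := ltn_ord i; lia.
have d0 : d = 0.
  apply: (@roots_geq_poly_eq0 _ _ [seq (val i)%:R | i <- enum 'I_K]).
  - apply/allP => _ /mapP[k _ ->]; rewrite rootE /d !hornerE horner_sum (bigD1 k) //=.
    rewrite hornerZ lE eqxx mulr1 big1 ?addr0 ?subrr // => i ik.
    by rewrite hornerZ lE (negbTE ik) mulr0.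
  - rewrite map_inj_uniq ?enum_uniq // => i j /eqP; rewrite eqr_nat => /eqP; exact: val_inj.
  - rewrite size_map size_enum_ord; apply: leq_trans (size_polyD _ _) _.
    rewrite geq_max sq size_polyN; apply: leq_trans (size_sum _ _ _) _.
    by apply/bigmax_leqP => i _; apply: leq_trans (size_scale_leq _ _) (sl i).
move/eqP: d0; rewrite subr_eq0 => /eqP {1}->; rewrite horner_sum.
by apply: eq_bigr => i _; rewrite hornerZ.
Qed.

(* the remainder of (1 + t)^s = \sum_k binc s k t^k for 1 + t = exp lam *)
Definition bin_tail K lam s : C :=
  cexp (s * lam%:C%C) - \sum_(k < K) binc s k * (expR lam - 1)%:C%C ^+ k.

(* Both truncated series are polynomials in s of degree < K, and the binomial
   one is exact at s = 0, ..., K - 1. *)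
Lemma bin_tailE K lam s : bin_tail K lam s =
  cexp_tail K (s * lam%:C%C)
  - \sum_(i < K) cexp_tail K (i%:R * lam%:C%C) * (lagr K i).[s].
Proof.
set t := (expR lam - 1)%:C%C.
pose T : {poly C} := \sum_(k < K) (lam%:C%C ^+ k / k`!%:R) *: 'X^k.
pose Bn : {poly C} := \sum_(k < K) (t ^+ k / k`!%:R) *: \prod_(j < k) ('X - (j%:R)%:P).
have TE z : T.[z] = \sum_(k < K) expt (z * lam%:C%C) k.
  rewrite horner_sum; apply: eq_bigr => k _; rewrite hornerZ hornerXn /expt exprMn; ring.
have BE z : Bn.[z] = \sum_(k < K) binc z k * t ^+ k.
  rewrite horner_sum; apply: eq_bigr => k _; rewrite hornerZ horner_prod /binc.
  under [X in _ * X = _]eq_bigr do rewrite hornerXsubC; ring.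
have sz : (size (T - Bn)%R <= K)%N.
  apply: leq_trans (size_polyD _ _) _; rewrite geq_max size_polyN; apply/andP; split.
    apply: leq_trans (size_sum _ _ _) _; apply/bigmax_leqP => k _.
    by apply: leq_trans (size_scale_leq _ _) _; rewrite size_polyXn.
  apply: leq_trans (size_sum _ _ _) _; apply/bigmax_leqP => k _.
  apply: leq_trans (size_scale_leq _ _) _.
  by rewrite size_prod_XsubC -[index_enum _]/(index_enum _) /index_enum -enumT size_enum_ord.
(* At an integer i < K the truncated binomial series is the whole expansion of (1 + t)^i. *)
have BN (i : 'I_K) : Bn.[i%:R] = cexp (i%:R * lam%:C%C).
  rewrite BE.
  have -> : (i%:R * lam%:C%C : C) = (i%:R * lam)%:C%C by rewrite rmorphM rmorph_nat.
  have eT : (expR lam)%:C%C = 1 + t by rewrite /t rmorphB rmorph1; ring.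
  rewrite cexp_real expRM_natl rmorphXn /= eT exprDn.
  rewrite (sum_ord_split (fun k => binc i%:R k * t ^+ k) (ltn_ord i)).
  rewrite [X in _ + X]big1 ?addr0 => [|k _]; last first.
    by rewrite binc_nat bin_small ?mul0r // leq_addr.
  apply: eq_bigr => k _; rewrite binc_nat expr1n mul1r -mulr_natl; ring.
rewrite /bin_tail -/t -BE /cexp_tail -TE.
have := interpolation s sz; rewrite !hornerE => h.
(* By [BN], the value of [T - Bn] at the node i is minus the exponential tail there. *)
have -> : cexp (s * lam%:C%C) - Bn.[s] = cexp (s * lam%:C%C) - T.[s] + (T.[s] - Bn.[s]).
  ring.
rewrite h; congr (_ + _); rewrite -[RHS]mulN1r mulr_sumr; apply: eq_bigr => i _.
by rewrite hornerD hornerN BN TE mulN1r -mulNr opprB.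
Qed.

Lemma wiener_poly (q : {poly C}) p r : 0 <= r -> exists B, wiener (fun z => q.[1 - z]) p r B.
Proof.
move=> r0; exists (\sum_(i < size q) (cabs q`_i * (cabs (1 - p) + r) ^+ i)).
apply: (@wiener_ext _ (fun z => \sum_(i < size q) q`_i * (1 - z) ^+ i)).
  by move=> z _; rewrite horner_coef.
apply: wiener_sum => // i; apply: wienerZ; apply: wienerX.
apply: wiener_ext (wienerD (wiener_cst (1 - p) p r0) (wienerN (wiener_center p r0))) => z _; ring.
Qed.

Lemma wiener_one_minus p r : 0 <= r -> wiener (fun z => 1 - z) p r (cabs (1 - p) + r).
Proof.
move=> r0; apply: wiener_ext (wienerD (wiener_cst (1 - p) p r0) (wienerN (wiener_center p r0))) => z _; ring.
Qed.

(** [bin_tailE] leaves only exponential tails, each of order lam^K in norm, and Lagrange polynomials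
    that do not depend on [lam]. Hence one constant [A] serves all [lam] in [0, Lam], and so all
    terms of the remainder series. *)
Lemma wiener_bin_tail K Lam p r : 0 < r -> exists2 A, 0 <= A &
  forall lam, 0 <= lam <= Lam -> wiener (fun z => bin_tail K lam (1 - z)) p r (A * lam ^+ K).
Proof.
move=> r0; have r0' := ltW r0.
have /choice[Bl hBl] : forall i, exists B, wiener (fun z => (lagr K i).[1 - z]) p r B.
  by move=> i; exact: wiener_poly.
pose B := cabs (1 - p) + r.
have B0 : 0 <= B by rewrite addr_ge0 ?cabs_ge0.
exists (B ^+ K * expR (B * Lam) + \sum_(i < K) (i%:R ^+ K * expR (i%:R * Lam) * Bl i)).
  rewrite addr_ge0 ?mulr_ge0 ?exprn_ge0 ?expR_ge0 //.
  apply: sumr_ge0 => i _; rewrite !mulr_ge0 ?exprn_ge0 ?expR_ge0 //.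
  exact: wiener_ge0 (hBl i).
move=> lam /andP[l0 lL].
have tail (g : C -> C) b : wiener g p r b ->
    wiener (fun z => cexp_tail K (g z * lam%:C%C)) p r (b ^+ K * expR (b * Lam) * lam ^+ K).
  move=> h; have b0 := wiener_ge0 h.
  apply: wiener_weaken (wiener_cexp_tail K r0 (wienerM h (wiener_cst lam%:C%C p r0'))) => //.
  rewrite cabs_real ger0_norm // exprMn mulrAC ler_wpM2r ?exprn_ge0 //.
  by rewrite ler_wpM2l ?exprn_ge0 // ler_expR ler_wpM2l.
apply: (@wiener_ext _ (fun z => cexp_tail K ((1 - z) * lam%:C%C)
  + - \sum_(i < K) cexp_tail K (i%:R * lam%:C%C) * (lagr K i).[1 - z])).
  by move=> z _; rewrite bin_tailE.
rewrite mulrDl; apply: wienerD; first exact: tail (wiener_one_minus p r0').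
apply: wienerN; rewrite mulr_suml; apply: wiener_sum => // i.
rewrite mulrAC; apply: wienerM; last exact: hBl.
by have := tail _ _ (wiener_cst i%:R p r0'); rewrite cabs_nat.
Qed.

End Binomial.

(** * Continuation of the Hurwitz zeta function *)

Section Hurwitz.
Variable R : realType.
Local Notation C := R[i].
Implicit Types (f g W : C -> C) (s p z : C) (lam r B sg : R).
Variable x : R.
Hypothesis x0 : 0 < x.

Lemma ReD z z' : complex.Re (z + z') = complex.Re z + complex.Re z'.
Proof. by case: z; case: z'. Qed.

Lemma ReB z z' : complex.Re (z - z') = complex.Re z - complex.Re z'.
Proof. by case: z; case: z'. Qed.

Lemma Re_nat n : complex.Re (n%:R : C) = n%:R.
Proof. by rewrite -(rmorph_nat (real_complex R)). Qed.

Definition lny (n : nat) : R := ln (n%:R + x).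
(** This is ln(1 + 1 / y_n), so that (1 + 1 / y_n)^s = exp(s lamn). *)
Definition lamn n : R := lny n.+1 - lny n.
Definition ypow n s : C := cexp (s * (lny n)%:C%C).

Lemma y_gt0 n : 0 < n%:R + x.
Proof. by rewrite ltr_wpDl ?ler0n. Qed.

Lemma expR_lny n : expR (lny n) = n%:R + x.
Proof. by rewrite lnK // posrE y_gt0. Qed.

Lemma expR_lamn n : expR (lamn n) = 1 + expR (- lny n).
Proof.
rewrite /lamn expRD expRN !expR_lny -natr1.
have := gt_eqF (y_gt0 n) => h; field; by rewrite h.
Qed.

Lemma lamn_ge0 n : 0 <= lamn n.
Proof. by rewrite -ler_expR expR0 expR_lamn lerDl expR_ge0. Qed.

Lemma lamn_le n : lamn n <= expR (- lny n).
Proof. by have := expR_ge1Dx (lamn n); rewrite expR_lamn lerD2l. Qed.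

Lemma lamn_ge n : expR (- lny n.+1) <= lamn n.
Proof.
have := expR_ge1Dx (- lamn n).
have -> : expR (- lamn n) = 1 - expR (- lny n.+1).
  rewrite /lamn opprB expRD !expRN !expR_lny -natr1.
  have := gt_eqF (y_gt0 n.+1); rewrite -natr1 => h; field; by rewrite h.
lra.
Qed.

Lemma lny_ge n : ln x <= lny n.
Proof. by rewrite ler_ln ?posrE ?y_gt0 // lerDr ler0n. Qed.

(** A bound independent of n, the [Lam] to which [wiener_bin_tail] is applied. *)
Lemma lamn_le_inv n : lamn n <= x^-1.
Proof.
apply: le_trans (lamn_le n) _; rewrite expRN lef_pV2 ?posrE ?expR_gt0 //.
by rewrite expR_lny lerDr ler0n.
Qed.

(** The integral test in telescoping form: exp(u) >= 1 + u and the lower bound 1 / y_(n+1) of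
    [lamn n] give (sg - 1) y_(n+1)^(- sg) <= y_n^(1 - sg) - y_(n+1)^(1 - sg). The term n = 0 is kept
    apart. *)
Lemma sum_ypow_le sg : 1 < sg -> exists B, forall n,
  \sum_(i < n) expR (- sg * lny i) <= B.
Proof.
move=> s1; have s0 : 0 < sg - 1 by rewrite subr_gt0.
exists (expR (- sg * lny 0) + expR ((1 - sg) * lny 0) / (sg - 1)).
case=> [|n]; first by rewrite big_ord0 addr_ge0 ?divr_ge0 ?expR_ge0 // ltW.
rewrite big_ord_recl lerD2l ler_pdivlMr //.
apply: (@le_trans _ _ (expR ((1 - sg) * lny 0) - expR ((1 - sg) * lny n))); last first.
  by rewrite lerBlDr lerDl expR_ge0.
elim: n => [|n IH]; first by rewrite big_ord0 mul0r subrr.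
rewrite big_ord_recr /= mulrDl.
suff : expR (- sg * lny n.+1) * (sg - 1) <=
    expR ((1 - sg) * lny n) - expR ((1 - sg) * lny n.+1) by lra.
have -> : lny n = lny n.+1 - lamn n by rewrite /lamn; ring.
set L := lny n.+1; set l := lamn n.
have -> : (1 - sg) * (L - l) = (1 - sg) * L + (sg - 1) * l by ring.
have -> : - sg * L = (1 - sg) * L + - L by ring.
rewrite !expRD -mulrA -[X in _ <= _ - X]mulr1 -mulrBr ler_wpM2l ?expR_ge0 //.
have h1 := expR_ge1Dx ((sg - 1) * l).
have h2 : expR (- L) * (sg - 1) <= l * (sg - 1) by rewrite ler_wpM2r ?(ltW s0) ?lamn_ge.
lra.
Qed.

Lemma ypowD n s s' : ypow n (s + s') = ypow n s * ypow n s'.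
Proof. by rewrite /ypow mulrDl cexpD. Qed.

Lemma cabs_ypow n s : cabs (ypow n s) = expR (complex.Re s * lny n).
Proof. by rewrite cabs_cexp; case: s => a b /=; rewrite mulr0 subr0. Qed.

Lemma ypow_nat n k : ypow n (- k%:R) = (expR (- lny n))%:C%C ^+ k.
Proof.
rewrite /ypow.
have -> : - k%:R * (lny n)%:C%C = (k%:R * - lny n)%:C%C :> C.
  by rewrite mulNr mulrN rmorphN rmorphM rmorph_nat.
by rewrite cexp_real expRM_natl rmorphXn.
Qed.

Lemma ypowS n s : ypow n.+1 s = ypow n s * cexp (s * (lamn n)%:C%C).
Proof.
rewrite /ypow -cexpD -mulrDr -rmorphD; have -> : lny n + lamn n = lny n.+1 by rewrite /lamn; ring.
by [].
Qed.

(** On the disc, y_n^(a - z) is y_n^(a - p) times exp(- (z - p) ln y_n), of norm at most exp(r |ln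
    y_n|). Replacing |ln y_n| by ln y_n, which may be negative when x < 1, costs the constant exp(2
    r |ln x|). *)
Lemma wiener_ypow a p r : 0 < r -> exists2 A, 0 <= A & forall n,
  wiener (fun z => ypow n (a - z)) p r (A * expR (- (complex.Re p - complex.Re a - r) * lny n)).
Proof.
move=> r0; exists (expR (2 * r * `|ln x|)); first exact: expR_ge0.
move=> n; apply: (@wiener_ext _ (fun z => ypow n (a - p) * cexp (- (z - p) * (lny n)%:C%C))).
  move=> z _; have -> : a - z = (a - p) + - (z - p) by ring.
  by rewrite [RHS]ypowD.
have hw := wiener_cexp r0 (wienerM (wienerN (wiener_center p (ltW r0))) (wiener_cst (lny n)%:C%C p (ltW r0))).
apply: wiener_weaken (wienerZ (ypow n (a - p)) hw) => //; first exact: ltW.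
rewrite cabs_ypow cabs_real -!expRD ler_expR.
rewrite ReB.
have h : `|lny n| <= lny n + 2 * `|ln x|.
  have := lny_ge n; have := ler_norm (ln x); have := ler_norm (- ln x); rewrite normrN.
  by case: (ger0P (lny n)); lra.
have := ler_wpM2l (ltW r0) h; nra.
Qed.

Definition csumv (u : nat -> C) : C := xget 0 [set l | csum u l].

Lemma csumvP u : (exists l, csum u l) -> csum u (csumv u).
Proof. by case=> l hl; rewrite /csumv; case: xgetP => [y ->//|/(_ l)]. Qed.

Lemma csumvE u l : csum u l -> csumv u = l.
Proof. by move=> h; apply: csum_uniq (h); apply: csumvP; exists l. Qed.

(** A Weierstrass test with majorant y_n^(- sg), which fits both the Dirichlet series and the
    remainder series. *)
Lemma hol_csumv (f : nat -> C -> C) p r A sg : 0 < r -> 1 < sg -> 0 <= A ->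
  (forall n, wiener (f n) p r (A * expR (- sg * lny n))) ->
  hol (fun z => csumv (f^~ z)) p /\ exists l, csum (f^~ p) l.
Proof.
move=> r0 s1 A0 hf; have [B hB] := sum_ypow_le s1.
have hs z : cabs (z - p) <= r -> exists l, csum (f^~ z) l.
  move=> hz; have [|l hl _] := @csum_ex _ (f^~ z) (A * B); last by exists l.
  move=> n; apply: le_trans (_ : \sum_(i < n) A * expR (- sg * lny i) <= _).
    by apply: ler_sum => i _; exact: wiener_bound (hf i) hz.
  by rewrite -mulr_sumr ler_wpM2l.
split; last by apply: hs; rewrite subrr cabs0 ltW.
exists r, (A * B); split=> //; apply: (wiener_csum r0 hf).
  by move=> n; rewrite -mulr_sumr ler_wpM2l.
by move=> z hz; apply: csumvP; exact: hs.
Qed.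

Definition dser z : C := csumv (fun n => ypow n (- z)).

Lemma dser_hol p : 1 < complex.Re p -> hol dser p.
Proof.
(* With r half the distance to the line Re z = 1, the exponent Re p - r is still above 1. *)
move=> p1; pose r := (complex.Re p - 1) / 2.
have r0 : 0 < r by rewrite divr_gt0 // subr_gt0.
have [A A0 hA] := @wiener_ypow 0 p r r0.
have [|h _] := @hol_csumv (fun n z => ypow n (0 - z)) p r A _ r0 _ A0 hA.
  by rewrite /r /=; lra.
by apply: hol_eq h => z; rewrite /dser; congr csumv; apply/funext => n; rewrite sub0r.
Qed.

Lemma dser_csum p : 1 < complex.Re p -> csum (fun n => ypow n (- p)) (dser p).
Proof.
move=> p1; pose r := (complex.Re p - 1) / 2.
have r0 : 0 < r by rewrite divr_gt0 // subr_gt0.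
have [A A0 hA] := @wiener_ypow 0 p r r0.
have [|_ [l hl]] := @hol_csumv (fun n z => ypow n (0 - z)) p r A _ r0 _ A0 hA.
  by rewrite /r /=; lra.
apply: csumvP; exists l; apply: csum_ext hl => n /=; by rewrite sub0r.
Qed.

Lemma lny_unbounded (M : R) : exists N, forall n, (N <= n)%N -> M < lny n.
Proof.
exists (Num.bound (expR M)) => n Nn; rewrite -ltr_expR expR_lny.
have h := archi_boundP (expR_ge0 M).
apply: lt_le_trans h _; apply: ler_wpDr; first exact: ltW.
by rewrite ler_nat.
Qed.

Lemma csum_telescope s : complex.Re s < 0 ->
  csum (fun n => ypow n s - ypow n.+1 s) (ypow 0 s).
Proof.
move=> s0 e e0; have [N hN] := lny_unbounded (ln e / complex.Re s).
exists N => n /hN {}hN.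
have -> : \sum_(i < n) (ypow i s - ypow i.+1 s) - ypow 0 s = - ypow n s.
  elim: n {hN} => [|n IH]; first by rewrite big_ord0 sub0r.
  by rewrite big_ord_recr /= addrAC IH; ring.
rewrite cabsN cabs_ypow -[e]lnK ?posrE // ltr_expR mulrC.
by rewrite -ltr_ndivrMr.
Qed.

Definition rser K z : C := csumv (fun n => ypow n (1 - z) * bin_tail K (lamn n) (1 - z)).

(** On a disc of radius r around p, y_n^(1 - z) is of order y_n^(1 - Re p + r) and the remainder of
    order y_n^(- K). For the chosen r the exponent Re p - 1 - r + K equals 1 + r, and r > 0 means Re
    p > 2 - K. *)
Lemma rser_spec K p : 2 - K%:R < complex.Re p -> hol (rser K) p /\
  csum (fun n => ypow n (1 - p) * bin_tail K (lamn n) (1 - p)) (rser K p).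
Proof.
move=> p1; pose r := (complex.Re p - 2 + K%:R) / 2.
have r0 : 0 < r by rewrite divr_gt0 //; lra.
have [A A0 hA] := @wiener_ypow 1 p r r0.
have [A' A'0 hA'] := wiener_bin_tail K x^-1 p r0.
have [|||h hs] := @hol_csumv (fun n z => ypow n (1 - z) * bin_tail K (lamn n) (1 - z))
    p r (A * A') (complex.Re p - 1 - r + K%:R) r0; last by split=> //; exact: csumvP.
- by rewrite /r; lra.
- exact: mulr_ge0.
move=> n; have hl : 0 <= lamn n <= x^-1 by rewrite lamn_ge0 lamn_le_inv.
apply: wiener_weaken (wienerM (hA n) (hA' _ hl)) => //; first exact: ltW.
rewrite mulrACA ler_wpM2l ?mulr_ge0 //.
apply: le_trans (_ : _ <= expR (- (complex.Re p - 1 - r) * lny n) * expR (- lny n) ^+ K) _.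
  by rewrite ler_wpM2l ?expR_ge0 // lerXn2r ?nnegrE ?lamn_ge0 ?expR_ge0 ?lamn_le.
rewrite -expRM_natl -expRD ler_expR /=; lra.
Qed.

Lemma hol_binc k f p : hol f p -> hol (fun z => binc (f z) k) p.
Proof.
move=> hf; apply: holM (hol_cst _ _); apply: hol_prod => j.
exact: holB hf (hol_cst _ _).
Qed.

Lemma hol_one_minus p : hol (fun z => 1 - z) p.
Proof. by apply: hol_eq (holN (hol_center 1 p)) => z; rewrite opprB. Qed.

Lemma hol_ypow n f p : hol f p -> hol (fun z => ypow n (f z)) p.
Proof. by move=> hf; apply: hol_cexp; exact: holM hf (hol_cst _ _). Qed.

(* W continues (z - 1) zeta(z, x) to the half-plane Re z > 1 - N *)
Definition continues (N : nat) W : Prop := [/\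
  forall p, 1 - N%:R < complex.Re p -> hol W p,
  forall z, 1 < complex.Re z -> W z = (z - 1) * dser z
  & (0 < N)%N -> W 1 = 1].

(** Summing the expansion of y_(n+1)^s - y_n^s over n. The coefficient of order k + 1 meets zeta(z +
    k, x), because y_n^s y_n^(-(k + 1)) = y_n^(-(z + k)). *)
Lemma dser_recursion K z : 1 < complex.Re z ->
  \sum_(k < K) binc (1 - z) k.+1 * dser (z + k%:R) + rser K.+1 z = - ypow 0 (1 - z).
Proof.
move=> z1; set s := 1 - z.
have [_ hr] : hol (rser K.+1) z /\ csum (fun n => ypow n (1 - z) * bin_tail K.+1 (lamn n) (1 - z)) (rser K.+1 z).
  by apply: rser_spec; have := ler0n R K; rewrite -natr1; lra.
have hs : complex.Re s < 0.
  by rewrite /s ReB (Re_nat 1); lra.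
have ht := csumZ (-1) (csum_telescope hs); rewrite mulN1r in ht.
apply: csum_uniq ht.
have hk (k : 'I_K) : csum (fun n => binc s k.+1 * ypow n (- (z + k%:R)))
    (binc s k.+1 * dser (z + k%:R)).
  by apply: csumZ; apply: dser_csum; rewrite ReD Re_nat ltr_wpDr.
apply: csum_ext (csumD (csum_sum (index_enum 'I_K) hk) hr) => n.
rewrite mulN1r opprB ypowS.
have -> : cexp (s * (lamn n)%:C%C) = bin_tail K.+1 (lamn n) s + (1 +
    \sum_(k < K) binc s k.+1 * (expR (- lny n))%:C%C ^+ k.+1).
  rewrite /bin_tail expR_lamn addDBl big_ord_recl /= binc0 expr0 mulr1.
  by rewrite subrK.
have -> : \sum_(k < K) binc s k.+1 * ypow n (- (z + k%:R)) =
    ypow n s * \sum_(k < K) binc s k.+1 * (expR (- lny n))%:C%C ^+ k.+1.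
  rewrite mulr_sumr; apply: eq_bigr => k _.
  have -> : - (z + k%:R) = s + - k.+1%:R by rewrite /s -natr1; ring.
  rewrite ypowD ypow_nat; ring.
rewrite -/s; ring.
Qed.

(** z + k is (z + k + 1) - 1, the factor that turns zeta(z + k + 1, x) into W(z + k + 1) and so
    cancels its pole. *)
Lemma binc_S_factor z k : binc (1 - z) k.+2 =
  - (binc (1 - z) k.+1 / k.+2%:R) * (z + k%:R).
Proof. rewrite bincS -[k.+1%:R]natr1; ring. Qed.

Lemma hurwitz_step N W : continues N W -> exists W', continues N.+1 W'.
Proof.
move=> [hW hD _].
exists (fun z => ypow 0 (1 - z)
  + \sum_(k < N) - (binc (1 - z) k.+1 / k.+2%:R) * W (z + k.+1%:R)
  + rser N.+2 z); split.
(* The order N + 2 makes the remainder holomorphic for Re z > 2 - (N + 2), exactly the new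
   half-plane. *)
- move=> p hp; apply: holD; last first.
    by apply: (rser_spec _).1; move: hp; rewrite -!natr1; lra.
  apply: holD; first exact: hol_ypow (hol_one_minus p).
  apply: hol_sum => k _; apply: holM.
    by apply: holN; apply: holM (hol_cst _ _); exact: hol_binc (hol_one_minus p).
  apply: hol_shift; apply: hW; rewrite ReD Re_nat.
  have := ler0n R k; move: hp; rewrite -!natr1; lra.
- move=> z z1; have := dser_recursion N.+1 z1.
  rewrite big_ord_recl /= bincS binc0 addr0 mul1r subr0 divr1.
  have -> : \sum_(i < N) binc (1 - z) (bump 0 i).+1 * dser (z + (bump 0 i)%:R) =
      \sum_(k < N) - (binc (1 - z) k.+1 / k.+2%:R) * W (z + k.+1%:R).
    apply: eq_bigr => k _; rewrite /bump add1n binc_S_factor hD; last first.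
      by rewrite ReD Re_nat ltr_wpDr.
    rewrite -[k.+1%:R]natr1; ring.
  move=> h; apply/eqP; rewrite -subr_eq0; apply/eqP.
  have -> : ypow 0 (1 - z) = - ((1 - z) * dser z
    + \sum_(k < N) - (binc (1 - z) k.+1 / k.+2%:R) * W (z + k.+1%:R) + rser N.+2 z).
    by rewrite h opprK.
  ring.
(* At z = 1, that is s = 0, the binomial coefficients of positive order and the remainder vanish,
   leaving y_0^0 = 1. *)
- move=> _; rewrite subrr.
  have -> : ypow 0 0 = 1 by rewrite /ypow mul0r cexp0.
  rewrite big1 ?addr0 => [|k _]; last by rewrite binc_0S mul0r oppr0 mul0r.
  have -> : rser N.+2 1 = 0; last by rewrite addr0.
  apply: csumvE; apply: csum_ext (@csum0 R) => n.
  rewrite /bin_tail subrr mul0r cexp0 big_ord_recl binc0 mul1r expr0 /=.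
  by rewrite big1 ?addr0 ?subrr ?mulr0 // => k _; rewrite binc_0S mul0r.
Qed.

Lemma hurwitz_continues N : exists W, continues N W.
Proof.
elim: N => [|N [W /hurwitz_step//]]; exists (fun z => (z - 1) * dser z); split=> //.
move=> p; rewrite subr0 => p1; apply: holM (hol_center 1 p) (dser_hol p1).
Qed.

Lemma hurwitz_entire : exists V : C -> C, [/\ forall p, hol V p,
  forall z, 1 < complex.Re z -> V z = (z - 1) * dser z & V 1 = 1].
Proof.
have [W hW] := choice hurwitz_continues.
have cons N M z : 1 - N%:R < complex.Re z -> 1 - M%:R < complex.Re z -> W N z = W M z.
  wlog NM : N M / (N <= M)%N => [hwl hN hM|hN _].
    by have [NM|/ltnW MN] := leqP N M; [exact: hwl|apply/esym; exact: hwl].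
  have [h1 h2 _] := hW N; have [h1' h2' _] := hW M.
  apply: (@hol_eq_halfplane _ _ _ (1 - N%:R) 1) hN => // [p hp|t ht].
    by apply: h1'; apply: le_lt_trans hp; rewrite lerD2l lerN2 ler_nat.
  by rewrite h2 ?h2'.
(* The half-plane of index [idx z] contains the unit disc around z, so near p the glued function
   coincides with the single function [W (idx p)]. *)
pose idx z := (Num.bound `|1 - complex.Re z|).+1.
have idxP z : 2 - (idx z)%:R < complex.Re z.
  have := archi_boundP (normr_ge0 (1 - complex.Re z)); rewrite /idx -natr1.
  by have := ler_norm (1 - complex.Re z); lra.
have idxP' z : 1 - (idx z)%:R < complex.Re z by have := idxP z; lra.
exists (fun z => W (idx z) z); split.
- move=> p; have [h1 _ _] := hW (idx p); apply: hol_ext (h1 p (idxP' p)).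
  exists 1 => [|z hz]; first exact: ltr01.
  apply: cons => //; have := idxP p; have := le_lt_trans (cabs_Re _) hz.
  by rewrite ReB ltr_norml; lra.
- by move=> z z1; have [_ h _] := hW (idx z); exact: h.
- by have [_ _] := hW (idx 1); exact.
Qed.

End Hurwitz.

(** * Laurent expansions, uniqueness of continuations and simple poles *)

Section Meromorphic.
Variable R : realType.
Local Notation C := R[i].
Implicit Types (f g h E F G : C -> C) (p q z : C) (r e B s x : R) (c rho : nat -> C).

(** At [q] the quotient is given by the shifted Taylor series, so its value there is the derivative
    [c 1]. This is the tool for splitting off a simple pole. *)
Lemma hol_divided_difference f q : (forall p, hol f p) ->
  exists2 g, (forall p, hol g p) & forall z, f z = f q + (z - q) * g z.
Proof.
move=> hf; have [c hc] := hol_taylor (hf q); have fq := taylor_at hc.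
pose g z := if z == q then c 1%N else (f z - f q) / (z - q).
exists g => [p|z]; last first.
  rewrite /g; have [->|zq] := eqVneq z q; first by rewrite subrr mul0r addr0.
  by rewrite mulrCA divff ?mulr1 ?subrKC // subr_eq0.
have [->|pq] := eqVneq p q.
  apply: (@taylor_hol _ _ _ (fun j => c j.+1)); case: hc => e e0 he.
  exists e => // z /he hz; rewrite /g; have [->|zq] := eqVneq z q.
    have := @csum_fin _ (fun j => c j.+1 * (q - q) ^+ j) 1%N.
    rewrite big_ord_recl big_ord0 expr0 mulr1 addr0; apply => -[//|i] _.
    by rewrite subrr expr0n mulr0.
  have zq' : z - q != 0 by rewrite subr_eq0.
  have := csumZ (z - q)^-1 (csum_recr hz); rewrite expr0 mulr1 -fq mulrC.
  apply: csum_ext => n; by rewrite exprS mulrCA mulKf.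
have n0 : 0 < cabs (p - q) by rewrite cabs_gt0 subr_eq0.
apply: (@hol_ext _ (fun z => (f z - f q) * (z - q)^-1)).
  exists (cabs (p - q)) => // z hz; rewrite /g; case: eqVneq => // zq.
  by move: hz; rewrite zq cabsB ltxx.
by apply: holM (hol_inv pq); apply: holB (hol_cst _ _).
Qed.

(** Filling in the value [c 0] at [p] turns a Laurent expansion into a Taylor expansion on a full
    neighbourhood, to which the lemmas on zeros apply. *)
Lemma laurent_atP f p N c : laurent_at f p N c <->
  taylor (fun z => if z == p then c 0%N else (z - p) ^+ N * f z) p c.
Proof.
split.
  move=> /dnbhs_cabsP[e e0 he]; exists e => // z hz; case: eqVneq => [->|zp].
    have := @csum_fin _ (fun j => c j * (p - p) ^+ j) 1%N.
    rewrite big_ord_recl big_ord0 expr0 mulr1 addr0; apply => -[//|i] _.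
    by rewrite subrr expr0n mulr0.
  exact/csumP/he.
move=> [e e0 he]; apply/dnbhs_cabsP; exists e => // z zp /he.
by rewrite (negbTE zp) => /csumP.
Qed.

Lemma laurent_intro f h p N c : taylor h p c ->
  (exists2 e, 0 < e & forall z, z != p -> cabs (z - p) < e -> (z - p) ^+ N * f z = h z) ->
  laurent_at f p N c.
Proof.
move=> hh [e e0 he]; apply/laurent_atP; apply: taylor_ext (hh).
exists e => // z /he hz; case: eqVneq hz => [->|zp] hz; first exact: taylor_at hh.
by rewrite hz.
Qed.

Lemma laurent_meromorphic_at f p N c : laurent_at f p N c -> meromorphic_at f p.
Proof.
move=> /laurent_atP h; exists N; eexists; split; first exact: taylor_hol h.
by exists 1 => [|z zp _]; rewrite ?ltr01 // (negbTE zp).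
Qed.

Lemma meromorphic_meromorphic_at F p : meromorphic F -> meromorphic_at F p.
Proof.
move=> /(_ p)[/hol_analytic/hol_meromorphic_at//|[N [_ [c _ /laurent_meromorphic_at//]]]].
Qed.

(** Every point is joined by a segment to s + 1, around which the unit disc lies in the half-plane
    of agreement. Poles may lie on the segment, hence the meromorphic form of [identity_segment]. *)
Lemma meromorphic_unique F G s : meromorphic F -> meromorphic G ->
  (forall z, s < complex.Re z -> F z = G z) -> forall p, zero_near (fun z => F z - G z) p.
Proof.
move=> hF hG hFG p; apply: (@identity_segment _ _ (s + 1)%:C%C).
  by move=> t _; apply: meromorphic_atB; exact: meromorphic_meromorphic_at.
apply: zero_near_open; exists 1 => [|z hz]; first exact: ltr01.
rewrite hFG ?subrr //; have := le_lt_trans (cabs_Re (z - (s + 1)%:C%C)) hz.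
rewrite ReB /= ltr_norml; lra.
Qed.

Lemma zero_near_laurent F G p N c : zero_near (fun z => F z - G z) p ->
  laurent_at F p N c -> laurent_at G p N c.
Proof.
move=> [e e0 he] /laurent_atP h; apply: laurent_intro h _.
by exists e => // z zp /(he _ zp)/subr0_eq->; rewrite (negbTE zp).
Qed.

Lemma zero_near_sym F G p : zero_near (fun z => F z - G z) p ->
  zero_near (fun z => G z - F z) p.
Proof. by move=> [e e0 he]; exists e => // z zp /(he _ zp)/subr0_eq->; rewrite subrr. Qed.

Lemma zero_near_pole F G p N : zero_near (fun z => F z - G z) p ->
  pole_of_order F p N -> pole_of_order G p N.
Proof.
move=> hz [N0 [c c0 hc]]; split; first exact: N0.
by exists c; [exact: c0|exact: zero_near_laurent hz hc].
Qed.

(* the shift by N' - N realigns the two expansions of (z - p)^(N + N') f *)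
Lemma laurent_unique f p N c N' c' : laurent_at f p N c -> laurent_at f p N' c' ->
  forall j, (if (N' <= j)%N then c (j - N')%N else 0) =
            (if (N <= j)%N then c' (j - N)%N else 0).
Proof.
move=> /laurent_atP h /laurent_atP h' j.
have := taylorB (taylor_shift N' h) (taylor_shift N h') => /taylor_isolated hs.
apply: subr0_eq; apply: (hs _ j) => e e0.
have [z [zp _ ze]] := pick_near p p e0; exists z; split=> //.
by rewrite (negbTE zp) mulrCA subrr.
Qed.

Lemma hol_laurent f p : hol f p -> exists c, laurent_at f p 0 c.
Proof.
move=> /hol_taylor[c hc]; exists c; apply: laurent_intro hc _.
by exists 1 => [|z _ _]; rewrite ?ltr01 // expr0 mul1r.
Qed.

(** If N' < N, comparing the coefficients of index N' would give c 0 = 0. *)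
Lemma pole_order_le f p N N' c' : pole_of_order f p N -> laurent_at f p N' c' -> (N <= N')%N.
Proof.
move=> [N0 [c c0 hc]] hc'; rewrite leqNgt; apply/negP => NN.
have := laurent_unique hc hc' N'; rewrite leqnn subnn leqNgt NN /= => /eqP.
exact/negP.
Qed.

Lemma hol_not_pole f p : hol f p -> ~ is_pole f p.
Proof.
move=> /hol_laurent[c hc] [N hN]; have := pole_order_le hN hc.
by case: hN => N0 _; rewrite leqNgt N0.
Qed.

(** Since [meromorphic] requires removable singularities to be removed, agreement around [p] with a
    holomorphic function extends to the value at [p]. *)
Lemma meromorphic_hol F G p : meromorphic G -> zero_near (fun z => F z - G z) p ->
  hol F p -> hol G p /\ G p = F p.
Proof.
move=> hG hz hF; have [/hol_analytic hGp|[N hN]] := hG p; last first.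
  by case: (hol_not_pole hF); exists N; apply: zero_near_pole hN; exact: zero_near_sym.
split=> //; have [e e0 /(_ p)] := hol_zero_near (holB hF hGp) hz.
by rewrite subrr cabs0 => /(_ e0)/subr0_eq.
Qed.

(** Every other expansion, of whatever order, yields the same coefficient by [laurent_unique], so
    the choice made in [residue] is harmless. *)
Lemma residue_simple f p c : laurent_at f p 1 c -> residue f p = c 0%N.
Proof.
move=> hc; apply: xget_unique; first by exists 1%N, c.
move=> _ [N [c' [hc' ->]]]; have := laurent_unique hc hc' N.
rewrite leqnn subnn; case: N hc' => [|N] _ /=; first by move->.
by rewrite subn1 => ->.
Qed.

Lemma continued_seriesP (u : nat -> C -> C) s F : meromorphic_continuation u s F ->
  meromorphic_continuation u s (continued_series u s) /\
  forall p, zero_near (fun z => F z - continued_series u s z) p.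
Proof.
move=> hF; have hG : meromorphic_continuation u s (continued_series u s).
  by rewrite /continued_series; case: xgetP => [G -> //|/(_ F)].
split=> //; case: hF hG => mF cF [mG cG]; apply: meromorphic_unique mF mG _ => z zs.
have /csumP hF := cF _ zs; have /csumP hG := cG _ zs; exact: csum_uniq hF hG.
Qed.

Definition principal m rho z : C := \sum_(k < m) rho k / (z - k.+1%:R).

(* f is only constrained off {1, ..., m}, where division by zero would give it
   junk values; rho k is the residue at k + 1. *)
Definition simple_poles m rho f : Prop := exists2 E, forall p, hol E p &
  forall z, (forall k, (k < m)%N -> z != k.+1%:R) -> f z = E z + principal m rho z.

Lemma simple_poles_entire m f : (forall p, hol f p) -> simple_poles m (fun=> 0) f.
Proof.
move=> hf; exists f => // z _; rewrite /principal big1 ?addr0 // => k _.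
by rewrite mul0r.
Qed.

Lemma simple_polesD m rho rho' f g : simple_poles m rho f -> simple_poles m rho' g ->
  simple_poles m (fun k => rho k + rho' k) (fun z => f z + g z).
Proof.
move=> [E hE fE] [E' hE' gE]; exists (fun z => E z + E' z) => [p|z hz].
  exact: holD.
rewrite fE // gE // addrACA; congr (_ + _); rewrite /principal -big_split.
by apply: eq_bigr => k _; rewrite mulrDl.
Qed.

Lemma simple_poles_eq m rho rho' f g : rho =1 rho' -> f =1 g ->
  simple_poles m rho f -> simple_poles m rho' g.
Proof. by move=> /funext -> /funext ->. Qed.

Lemma simple_poles_sum (I : Type) (t : seq I) m (rho : I -> nat -> C) (f : I -> C -> C) :
  (forall i, simple_poles m (rho i) (f i)) ->
  simple_poles m (fun k => \sum_(i <- t) rho i k) (fun z => \sum_(i <- t) f i z).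
Proof.
move=> h; elim: t => [|i t IH].
  apply: simple_poles_eq (simple_poles_entire m (hol_cst 0)) => z.
    by rewrite big_nil.
  by rewrite big_nil.
by apply: simple_poles_eq (simple_polesD (h i) IH) => z; rewrite big_cons.
Qed.

(** g(z) / (z - k - 1) is g(k + 1) / (z - k - 1) plus the divided difference of [g], which is
    entire; the residue is thus multiplied by g(k + 1). *)
Lemma simple_polesM m rho f g : (forall p, hol g p) -> simple_poles m rho f ->
  simple_poles m (fun k => g k.+1%:R * rho k) (fun z => g z * f z).
Proof.
move=> hg [E hE fE].
have /choice[G hG] : forall k : nat, exists G, (forall p, hol G p) /\
    forall z, g z = g k.+1%:R + (z - k.+1%:R) * G z.
  by move=> k; have [G h1 h2] := hol_divided_difference k.+1%:R hg; exists G.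
exists (fun z => g z * E z + \sum_(k < m) rho k * G k z) => [p|z hz].
  apply: holD; first exact: holM.
  by apply: hol_sum => k _; apply: holZ; exact: (hG k).1.
rewrite fE // mulrDr -addrA; congr (_ + _); rewrite /principal mulr_sumr -big_split /=.
apply: eq_bigr => k _; have zk : z - k.+1%:R != 0 by rewrite subr_eq0 hz.
rewrite {1}((hG k).2 z); move: (k.+1%:R : C) zk => u zk; by field.
Qed.

(** The entire function V(z) = (z - 1) zeta(z, x) is V(1) + (z - 1) A(z); dividing by z - 1, the
    value V(1) = 1 becomes the residue. *)
Lemma hurwitz_continuation x : 0 < x -> exists2 A : C -> C, forall p, hol A p &
  forall z, 1 < complex.Re z ->
    csum (fun n => (cpow (n%:R + x) z)^-1) ((z - 1)^-1 + A z).
Proof.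
move=> x0; have [V [hV VE V1]] := hurwitz_entire x0.
have [A hA VA] := hol_divided_difference 1 hV; exists A => // z z1.
have z1' : z - 1 != 0.
  by apply/eqP => /subr0_eq e; move: z1; rewrite e (Re_nat R 1) ltxx.
have -> : (z - 1)^-1 + A z = dser x z.
  apply: (mulfI z1'); rewrite -VE // VA V1 mulrDr divff //.
apply: csum_ext (dser_csum x0 z1) => n.
have yn : 0 < n%:R + x := y_gt0 x0 n.
have -> : cpow (n%:R + x) z = ypow x n z.
  rewrite /cpow /ypow /cexp /powR gt_eqF // /lny.
  by case: z {z1 z1'} => a b /=; rewrite !mulr0 subr0 add0r.
apply: (mulfI (cexp_neq0 (z * (lny x n)%:C%C))); rewrite -/(ypow x n z) -ypowD subrr divff ?cexp_neq0 //.
by rewrite /ypow mul0r cexp0.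
Qed.

Lemma simple_poles_meromorphic m rho E : (forall p, hol E p) ->
  let F z := E z + principal m rho z in
  [/\ meromorphic F,
      forall p, (forall k, (k < m)%N -> p != k.+1%:R) -> hol F p &
      forall k, (k < m)%N -> (rho k = 0 -> hol F k.+1%:R) /\
        exists2 c, c 0%N = rho k & laurent_at F k.+1%:R 1 c].
Proof.
move=> hE F.
have hol_away p : (forall k, (k < m)%N -> p != k.+1%:R) -> hol F p.
  move=> hp; apply: holD => //; apply: hol_sum => k _; apply: holM (hol_cst _ _) _.
  exact: hol_inv (hp _ (ltn_ord k)).
have at_pole k : (k < m)%N -> exists2 G, hol G k.+1%:R &
    forall z, F z = rho k / (z - k.+1%:R) + G z.
  move=> km; exists (fun z => E z +
    \sum_(i < m | i != Ordinal km) rho i / (z - i.+1%:R)) => [|z].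
    apply: holD => //; apply: hol_sum => i ik; apply: holM (hol_cst _ _) _.
    by apply: hol_inv; rewrite eqr_nat eqSS eq_sym.
  by rewrite /F /principal (bigD1 (Ordinal km)) //= addrCA.
have hk k : (k < m)%N -> (rho k = 0 -> hol F k.+1%:R) /\
        exists2 c, c 0%N = rho k & laurent_at F k.+1%:R 1 c.
  move=> km; have [G hG FG] := at_pole k km; split=> [r0|].
    (* With a zero residue the fraction is 0 / 0 = 0 at the point itself, so [F] is holomorphic
       there without correction. *)
    by apply: hol_eq hG => z; rewrite FG r0 mul0r add0r.
  have [c hc] : exists c, taylor (fun z => rho k + (z - k.+1%:R) * G z) k.+1%:R c.
    apply: hol_taylor; apply: holD (hol_cst _ _) _; apply: holM hG; exact: hol_center.
  exists c; first by rewrite -(taylor_at hc) subrr mul0r addr0.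
  apply: laurent_intro hc _; exists 1 => [|z zk _]; first exact: ltr01.
  rewrite FG expr1; have : z - k.+1%:R != 0 by rewrite subr_eq0.
  by move: (k.+1%:R : C) => u zu; field.
split=> // p.
have [[k [km ->]]|np] := pselect (exists k, (k < m)%N /\ p = k.+1%:R); last first.
  left; apply/hol_analytic/hol_away => k km; apply/eqP => pk.
  by apply: np; exists k.
have [h0 [c c0 hc]] := hk k km; have [r0|r0] := eqVneq (rho k) 0.
  by left; apply/hol_analytic; exact: h0.
by right; exists 1%N; split=> //; exists c; rewrite ?c0.
Qed.

Lemma hurwitz_zetaP x : 0 < x ->
  [/\ forall z, 1 < complex.Re z ->
        csum (fun n => (cpow (n%:R + x) z)^-1) (hurwitz_zeta z x) &
      exists2 A : C -> C, forall p, hol A p &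
        forall z, z != 1 -> hurwitz_zeta z x = (z - 1)^-1 + A z].
Proof.
move=> x0; have [A hA hs] := hurwitz_continuation x0.
pose F z := A z + principal 1 (fun=> 1) z.
have FE z : F z = (z - 1)^-1 + A z.
  by rewrite /F /principal big_ord_recl big_ord0 addr0 mul1r addrC.
have [mF hF _] := simple_poles_meromorphic 1 (fun=> 1) hA.
have cF : meromorphic_continuation (fun n t => (cpow (n%:R + x) t)^-1) 1 F.
  by split=> // z z1; apply/csumP; rewrite FE; exact: hs.
have [[mZ hZ] hz] := continued_seriesP cF; split=> [z /hZ /csumP//|].
exists A => // z z1; rewrite -FE.
by apply: (meromorphic_hol mZ (hz z) _).2; apply: hF => -[].
Qed.

(** The pole is where z - k + l = 1, that is z = (k - l) + 1. *)
Lemma simple_poles_hurwitz m x k l : 0 < x -> (l <= k)%N -> (k < m)%N ->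
  simple_poles m (fun i => (i == (k - l)%N)%:R)
    (fun z => hurwitz_zeta (z - k%:R + l%:R) x).
Proof.
move=> x0 lk km; have [_ [A hA hz]] := hurwitz_zetaP x0.
have kl : (k - l < m)%N by apply: leq_ltn_trans km; exact: leq_subr.
exists (fun z => A (z + (l%:R - k%:R))) => [p|z hzk]; first exact: hol_shift.
have e : z - k%:R + l%:R - 1 = z - (k - l).+1%:R by rewrite -natr1 natrB //; ring.
rewrite hz; last by rewrite -subr_eq0 e subr_eq0 hzk.
rewrite e addrC; congr (A _ + _); first by ring.
rewrite /principal (bigD1 (Ordinal kl)) //= eqxx mul1r big1 ?addr0 // => i ik.
by rewrite (_ : (i == (k - l)%N :> nat) = false) ?mul0r //; apply: negbTE.
Qed.

End Meromorphic.

(** * The zeta function of a function that is eventually a quasi-polynomial *)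

Section Dirichlet.
Variable R : realType.
Local Notation C := R[i].
Implicit Types (p z : C) (x y : R).

Lemma cpowE x z : 0 < x -> cpow x z = cexp (z * (ln x)%:C%C).
Proof.
move=> x0; rewrite /cpow /cexp /powR gt_eqF //.
by case: z => a b /=; rewrite !mulr0 subr0 add0r.
Qed.

Lemma cpow_neq0 x z : 0 < x -> cpow x z != 0.
Proof. by move=> x0; rewrite cpowE // cexp_neq0. Qed.

Lemma cpowM x y z : 0 < x -> 0 < y -> cpow (x * y) z = cpow x z * cpow y z.
Proof.
move=> x0 y0; rewrite !cpowE ?mulr_gt0 // lnM ?posrE // rmorphD mulrDr; exact: cexpD.
Qed.

Lemma cpowD x z z' : 0 < x -> cpow x (z + z') = cpow x z * cpow x z'.
Proof. by move=> x0; rewrite !cpowE // mulrDl cexpD. Qed.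

Lemma cpow_nat x k : 0 < x -> cpow x k%:R = x%:C%C ^+ k.
Proof.
move=> x0; rewrite cpowE //.
have -> : k%:R * (ln x)%:C%C = (k%:R * ln x)%:C%C :> C by rewrite rmorphM rmorph_nat.
by rewrite cexp_real expRM_natl lnK ?posrE // rmorphXn.
Qed.

Lemma cpowN x z : 0 < x -> cpow x (- z) = (cpow x z)^-1.
Proof.
move=> x0; apply: (mulfI (cpow_neq0 z x0)); rewrite -cpowD // subrr divff ?cpow_neq0 //.
by have := cpow_nat 0 x0; rewrite expr0.
Qed.

Lemma cpow_subn x z k : 0 < x -> (cpow x (z - k%:R))^-1 = x%:C%C ^+ k / cpow x z.
Proof.
by move=> x0; rewrite -cpowN // opprB cpowD // cpow_nat // cpowN.
Qed.

(** Among 0, ..., N - 1 the class of j has one element in each of the N / D full periods, and one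
    more when j < N mod D. *)
Lemma sum_residue (v : nat -> C) D j N : (j < D)%N ->
  \sum_(n < N) (if (n %% D == j)%N then v n else 0) =
  \sum_(n < N %/ D + (j < N %% D)) v (n * D + j)%N.
Proof.
move=> jD; have D0 : (0 < D)%N by apply: leq_ltn_trans jD.
elim: N => [|N IH]; first by rewrite div0n mod0n !big_ord0.
rewrite big_ord_recr /= IH; set a := (N %/ D)%N; set b := (N %% D)%N.
have NE : N = (a * D + b)%N by exact: divn_eq.
have bD : (b < D)%N by rewrite ltn_mod.
have [bD'|] := ltnP b.+1 D.
  have -> : (N.+1 %/ D = a)%N by rewrite NE -addnS divnMDl // divn_small ?addn0.
  have -> : (N.+1 %% D = b.+1)%N by rewrite NE -addnS modnMDl modn_small.
  have [bj|bj] := eqVneq b j.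
    by rewrite -bj ltnn ltnS leqnn addn0 addn1 big_ord_recr /= -NE.
  by rewrite addr0 (_ : (j < b) = (j < b.+1))%N // ltnS [in RHS]leq_eqVlt eq_sym (negbTE bj).
move=> Db; have bE : b.+1 = D by apply/eqP; rewrite eqn_leq bD Db.
have NE' : N.+1 = (a.+1 * D)%N by rewrite NE -addnS bE mulSn addnC.
have -> : (N.+1 %/ D = a.+1)%N by rewrite NE' mulnK.
have -> : (N.+1 %% D = 0)%N by rewrite NE' modnMl.
rewrite ltn0 addn0; have [bj|bj] := eqVneq b j.
  by rewrite -bj ltnn addn0 big_ord_recr /= -NE.
have jb : (j < b)%N by rewrite ltn_neqAle eq_sym bj -ltnS bE.
by rewrite jb addn1 addr0.
Qed.

(** Padding each class with zeros gives all of them the common index n, so convergence class by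
    class suffices and nothing is rearranged. *)
Lemma csum_residues (v : nat -> C) D (l : nat -> C) : (0 < D)%N ->
  (forall j, (j < D)%N -> csum (fun n => v (n * D + j)%N) (l j)) ->
  csum v (\sum_(j < D) l j).
Proof.
move=> D0 h.
have hj (j : 'I_D) : csum (fun n => if (n %% D == j)%N then v n else 0) (l j).
  move=> e e0; have [N hN] := h j (ltn_ord j) e e0.
  exists (N * D)%N => n Nn; rewrite sum_residue //; apply: hN.
  by apply: leq_trans (leq_addr _ _); rewrite leq_divRL.
apply: csum_ext (csum_sum (index_enum 'I_D) hj) => n.
have nD : (n %% D < D)%N by rewrite ltn_mod.
rewrite (bigD1 (Ordinal nD)) //= eqxx big1 ?addr0 // => j jn.
rewrite ifN //; apply: contra jn => /eqP e; apply/eqP/val_inj => /=; by rewrite e.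
Qed.

(** A window of D consecutive integers meets each residue class once, wherever it starts; this
    removes [al] from the residues. *)
Lemma sum_periodic (f : nat -> C) D al : (forall n, f (n + D)%N = f n) ->
  \sum_(j < D) f (j + al)%N = \sum_(j < D) f j.
Proof.
move=> hf; elim: al => [|al IH]; first by apply: eq_bigr => j _; rewrite addn0.
rewrite -IH; case: D hf {IH} => [|D] hf; first by rewrite !big_ord0.
rewrite big_ord_recr [RHS]big_ord_recl /= addrC addnS -addSn addnC hf add0n; congr (_ + _).
by apply: eq_bigr => j _; rewrite addnS.
Qed.

Lemma periodic_mul (f : nat -> C) D n i : (forall n, f (n + D)%N = f n) ->
  f (n * D + i)%N = f i.
Proof.
move=> hf; elim: n => [|n IH]; first by rewrite mul0n.
by rewrite mulSn -addnA addnC hf.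
Qed.

Lemma alphaP (H : nat -> nat) (q : nat -> C) :
  (exists n0, agree_from H q n0) -> agree_from H q (alpha H q).
Proof.
case=> n0 h0; rewrite /alpha; case: xgetP => [y -> []//|hn].
have ex : exists n, `[< agree_from H q n >] by exists n0; apply/asboolP.
case: (ex_minnP ex) => n1 /asboolP h1 hmin; case: (hn n1).
by split=> // n2 h2; apply: hmin; apply/asboolP.
Qed.

Definition zeta_rhs (H : nat -> nat) (D m al : nat) (w : R) (d : nat -> nat -> C) z : C :=
  theta_mod H al w z + cpow D%:R (- z) *
    \sum_(k < m) \sum_(j < D) d k (j + al)%N *
      \sum_(l < k.+1) 'C(k, l)%:R * (- w%:C%C) ^+ l * D%:R ^+ (k - l) *
        hurwitz_zeta (z - k%:R + l%:R) ((j%:R + al%:R + w) / D%:R).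

Variables (H : nat -> nat) (D m : nat) (w : R) (d : nat -> nat -> C).
Hypotheses (D0 : (0 < D)%N) (w0 : 0 < w).
Let al := alpha H (quasi_poly m d).
Hypothesis dper : forall k n, (k < m)%N -> d k (n + D)%N = d k n.
Hypothesis agr : agree_from H (quasi_poly m d) al.

Let X j : R := (j%:R + al%:R + w) / D%:R.

Lemma X_gt0 j : 0 < X j.
Proof. by rewrite divr_gt0 ?ltr0n // ltr_wpDl // addr_ge0. Qed.

Lemma zeta_term_split j n z : (j < D)%N ->
  zeta_term H w ((n * D + j) + al) z = cpow D%:R (- z) *
    \sum_(k < m) d k (j + al)%N *
      \sum_(l < k.+1) 'C(k, l)%:R * (- w%:C%C) ^+ l * D%:R ^+ (k - l) *
        (cpow (n%:R + X j) (z - k%:R + l%:R))^-1.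
Proof.
move=> jD; set N := (n * D + j + al)%N.
have DR : (0 : R) < D%:R by rewrite ltr0n.
have t0 : 0 < n%:R + X j by rewrite ltr_wpDl // X_gt0.
have yE : N%:R + w = D%:R * (n%:R + X j).
  rewrite /X mulrDr [_ * (_ / _)]mulrCA divff ?gt_eqF // mulr1 /N !natrD natrM; ring.
rewrite /zeta_term agr ?leq_addl // /quasi_poly mulr_suml mulr_sumr.
apply: eq_bigr => -[k km] _ /=.
have -> : d k N = d k (j + al)%N.
  by rewrite /N -addnA (periodic_mul _ _ (fun n => dper n km)).
rewrite mulrCA -mulrA; congr (_ * _).
have e1 : (N%:R : C) = (N%:R + w)%:C%C - w%:C%C.
  by rewrite -(rmorph_nat (real_complex R)) -rmorphB /= addrK.
rewrite {1}e1.
rewrite exprDn mulr_suml mulr_sumr; apply: eq_bigr => -[l lk] _ /=.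
rewrite ltnS in lk.
have -> : z - k%:R + l%:R = z - (k - l)%:R by rewrite natrB //; ring.
rewrite cpow_subn // yE cpowM // cpowN // rmorphM rmorph_nat exprMn -mulr_natl invfM.
ring.
Qed.

Lemma zeta_term_csum z : m%:R < complex.Re z ->
  csum (fun n => zeta_term H w n z) (zeta_rhs H D m al w d z).
Proof.
move=> hz; apply: (@csum_undrop _ (fun n => zeta_term H w n z) _ al).
rewrite exchange_big mulr_sumr /=.
apply: (@csum_residues _ D (fun j => cpow D%:R (- z) * \sum_(k < m) d k (j + al)%N *
      \sum_(l < k.+1) 'C(k, l)%:R * (- w%:C%C) ^+ l * D%:R ^+ (k - l) *
        hurwitz_zeta (z - k%:R + l%:R) (X j)) D0) => j jD.
apply: (@csum_ext _ _ _ _ (fun n => esym (zeta_term_split n z jD))).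
apply: csumZ; apply: csum_sum => -[k km] /=; apply: csumZ.
apply: csum_sum => -[l lk] /=; apply: csumZ.
have [h _] := hurwitz_zetaP (X_gt0 j); apply: h; rewrite ReD ReB !Re_nat.
(* As k + 1 <= m < Re z, each argument z - k + l has real part above 1, so each Hurwitz series
   converges. *)
have : (k.+1%:R : R) <= m%:R by rewrite ler_nat.
have := ler0n R l; rewrite -natr1; lra.
Qed.

Lemma hol_cpow f x p : 0 < x -> hol f p -> hol (fun z => cpow x (f z)) p.
Proof.
move=> x0 hf; apply: hol_eq (hol_cexp (holM hf (hol_cst (ln x)%:C%C p))) => z.
by rewrite cpowE.
Qed.

Lemma hol_opp p : hol (fun z : C => - z) p.
Proof. by apply: hol_eq (holN (hol_center 0 p)) => z; rewrite subr0. Qed.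

Definition zeta_residue k : C :=
  D%:R^-1 * \sum_(k <= l < m) 'C(l, k)%:R * (- w%:C%C) ^+ (l - k) * \sum_(j < D) d l j.

(** Only l = k - i gives a Hurwitz term with a pole at i + 1, and such an l exists just when i <=
    k. *)
Lemma sum_pole_indicator (F : nat -> C) i k :
  \sum_(l < k.+1) F l * (i == (k - l)%N)%:R = if (i <= k)%N then F (k - i)%N else 0.
Proof.
case: ifP => ik; last first.
  rewrite big1 // => -[l /= lk] _; case: eqVneq => [e|]; last by rewrite mulr0.
  by move: ik; rewrite e leq_subr.
have h : (k - i < k.+1)%N by rewrite ltnS leq_subr.
rewrite (bigD1 (Ordinal h)) //= subKn // eqxx mulr1 big1 ?addr0 // => -[l /= lk] hl.
case: eqVneq => [e|]; last by rewrite mulr0.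
move: hl; rewrite -val_eqE /= e subKn ?eqxx //.
Qed.

Lemma zeta_rhs_poles : simple_poles m zeta_residue (zeta_rhs H D m al w d).
Proof.
have DR : (0 : R) < D%:R by rewrite ltr0n.
have hcp p : hol (fun z : C => cpow D%:R (- z)) p by apply: hol_cpow (hol_opp p).
have hth p : hol (theta_mod H al w) p.
  apply: hol_sum => n _; apply: holM (hol_cst _ _) _.
  have yn : 0 < n%:R + w by rewrite ltr_wpDl.
  by apply: hol_eq (hol_cpow yn (hol_opp p)) => z; rewrite cpowN.
(* The summand 0 comes from the entire function [theta_mod]; in the rest each entire factor is
   evaluated at the pole i + 1. *)
pose rho i : C := 0 + cpow D%:R (- i.+1%:R) *
    \sum_(k < m) \sum_(j < D) d k (j + al)%N *
      \sum_(l < k.+1) 'C(k, l)%:R * (- w%:C%C) ^+ l * D%:R ^+ (k - l) * (i == (k - l)%N)%:R.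
have : simple_poles m rho (zeta_rhs H D m al w d).
  apply: simple_polesD (simple_poles_entire m hth) _.
  apply: simple_polesM hcp _.
  apply: simple_poles_sum => -[k km] /=; apply: simple_poles_sum => j.
  apply: (@simple_polesM _ _ _ _ (fun=> d k (j + al)%N)); first by move=> p; exact: hol_cst.
  apply: simple_poles_sum => -[l lk] /=.
  apply: (@simple_polesM _ _ _ _ (fun=> 'C(k, l)%:R * (- w%:C%C) ^+ l * D%:R ^+ (k - l))).
    by move=> p; exact: hol_cst.
  exact: simple_poles_hurwitz (X_gt0 j) _ km.
apply: simple_poles_eq => // i; rewrite /rho /zeta_residue add0r.
rewrite cpowN // cpow_nat // rmorph_nat.
rewrite big_geq_mkord /= [LHS]mulr_sumr [RHS]mulr_sumr [RHS]big_mkcond /=.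
apply: eq_bigr => -[k km] _ /=.
pose F l : C := 'C(k, l)%:R * (- w%:C%C) ^+ l * D%:R ^+ (k - l).
under [X in _ * X = _]eq_bigr do rewrite (sum_pole_indicator F).
case: ifP => ik; last by rewrite big1 ?mulr0 // => j _; rewrite mulr0.
(* For l = k - i the power of D is D^i, which against D^(-(i + 1)) leaves 1 / D. *)
rewrite -mulr_suml /F subKn // bin_sub // (sum_periodic _ (fun n => dper n km)).
have DC : (D%:R : C) != 0 by rewrite pnatr_eq0 -lt0n.
rewrite exprS invfM; have : (D%:R : C) ^+ i != 0 by rewrite expf_neq0.
by move: (D%:R ^+ i : C) => Di Di0; field; rewrite Di0 DC.
Qed.

(** Everything holds for the explicit sum of [E] and the simple fractions, and is carried to the
    chosen continuation, which agrees with it on punctured neighbourhoods: Laurent coefficients are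
    transported, and so are values where the explicit function is holomorphic. *)
Lemma zeta_mod_poles (zetaM := zeta_mod H m w) : [/\
  meromorphic_continuation (zeta_term H w) m%:R zetaM,
  forall z, (forall k, (k < m)%N -> z != k.+1%:R) ->
    hol zetaM z /\ zetaM z = zeta_rhs H D m al w d z &
  forall k, (k < m)%N -> (zeta_residue k = 0 -> hol zetaM k.+1%:R) /\
    exists2 c, c 0%N = zeta_residue k & laurent_at zetaM k.+1%:R 1 c].
Proof.
have [E hE EF] := zeta_rhs_poles.
have [mF hF hP] := simple_poles_meromorphic m zeta_residue hE.
have cF : meromorphic_continuation (zeta_term H w) m%:R
    (fun z => E z + principal m zeta_residue z).
  split=> // z hz; apply/csumP; rewrite -EF; first exact: zeta_term_csum.
  move=> k km; apply/eqP => e; move: hz; rewrite e Re_nat ltr_nat.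
  by rewrite ltnNge km.
have [cZ hZ] := continued_seriesP cF; have [mZ _] := cZ.
split; [exact: cZ|move=> z hz|move=> k km].
  have [h1 h2] := meromorphic_hol mZ (hZ z) (hF z hz).
  by split=> //; rewrite /zetaM /zeta_mod h2 -EF.
have [h1 [c c0 hc]] := hP k km; split.
  by move=> /h1 h; have [] := meromorphic_hol mZ (hZ _) h.
by exists c; [exact: c0|exact: zero_near_laurent (hZ _) hc].
Qed.

End Dirichlet.

Theorem theorem1p1
  (R : realType) (K : fieldType) (S : comAlgType K) (grS : nat -> set S)
  (r : nat) (u : 'I_r -> S) (a : 'I_r -> nat)
  (M : lmodType S) (grM : nat -> set M) (m : nat) (w : R)
  (d : nat -> nat -> R[i])
  (D := \big[lcmn/1%N]_(i < r) a i)
  (H := hilbert grM)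
  (al := alpha H (quasi_poly m d))
  (zetaM := zeta_mod H m w)
  (hS : positively_graded_algebra grS u a)
  (hM : is_graded_module grS grM)
  (hfg : finitely_generated M)
  (hm : has_krull_dim M m)
  (hd : is_quasi_poly_of H D m d)
  (hw : 0 < w) :
  [/\ meromorphic_continuation (zeta_term H w) m%:R zetaM,
      (* identity of meromorphic functions: the Hurwitz terms are defined at
         every z outside {1, ..., m} *)
      forall z : R[i], (forall k, (k < m)%N -> z != k.+1%:R) ->
        zetaM z = theta_mod H al w z
          + cpow D%:R (- z) *
            \sum_(k < m) \sum_(j < D) d k (j + al)%N *
              \sum_(l < k.+1) 'C(k, l)%:R * (- w%:C%C) ^+ l * D%:R ^+ (k - l) *
                hurwitz_zeta (z - k%:R + l%:R) ((j%:R + al%:R + w) / D%:R),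
      forall z : R[i], is_pole zetaM z ->
        (exists2 k, (k < m)%N & z = k.+1%:R) /\
        (forall N, pole_of_order zetaM z N -> N = 1%N)
    & forall k, (k < m)%N ->
        residue zetaM k.+1%:R =
          D%:R^-1 * \sum_(k <= l < m) 'C(l, k)%:R * (- w%:C%C) ^+ (l - k) *
                      \sum_(j < D) d l j
        /\ (residue zetaM k.+1%:R = 0 <-> ~ is_pole zetaM k.+1%:R)].
Proof.
have D0 : (0 < D)%N.
  have [_ _ ha _] := hS; rewrite /D; elim/big_ind: _ => // [x y x0 y0|i _].
    by rewrite lcmn_gt0 x0.
  by have [] := ha i.
have [dper _ /alphaP agr] := hd.
have [cZ eZ pZ] := zeta_mod_poles D0 hw dper agr.
split; [exact: cZ|move=> z hz|move=> z zp|move=> k km].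
- exact: (eZ z hz).2.
- have [[k [km ->]]|np] := pselect (exists k, (k < m)%N /\ z = k.+1%:R); last first.
    case: (hol_not_pole _ zp); apply: (eZ z _).1 => k km; apply/eqP => zk.
    by apply: np; exists k.
  split=> [|N hN]; first by exists k.
  (* The expansion of order 1 bounds the order of any pole by 1. *)
  have [_ [c _ hc]] := pZ k km; have := pole_order_le hN hc.
  by case: hN => N0 _; case: N N0 => [//|[]].
have [h0 [c c0 hc]] := pZ k km; have rE := residue_simple hc.
split; first by rewrite rE c0.
rewrite rE c0; split=> [/h0/hol_not_pole //|np].
(* A nonzero residue is the leading coefficient of the expansion of order 1, which then exhibits a
   pole. *)
have [//|r0] := eqVneq (zeta_residue D m w d k) 0.
by case: np; exists 1%N; split=> //; exists c; rewrite ?c0.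
Qed.
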